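(* The \textsc{Min-Key} problem is polynomial-time reducible to the \textsc{Min-TSS} problem.
   Context: \textsc{Min-Key}: given a pure Horn CNF $\Phi$ over variable set $V$ (a conjunction of implications $A\to v$, $A\subseteq V$, $v\in V$, meaning $v\vee\bigvee_{a\in A}\bar a$), find a key of minimum size, where $K\subseteq V$ is a key if $K\to u$ is implied by $\Phi$ for all $u\in V\setminus K$ (equivalently, forward chaining from $K$ using the clauses of $\Phi$ reaches all of $V$). \textsc{Min-TSS}: given an undirected graph $G=(V',E)$ and thresholds $t$ on $V'$, find a target set of minimum size, where $S\subseteq V'$ is a target set if, starting with $S$ active and in each round activating every vertex $v$ with at least $t(v)$ active neighbors, eventually all vertices become active. A polynomial-time reduction from problem $P$ to problem $Q$ means a polynomial-time transformation of each instance $I$ of $P$ into an instance $I'$ of $Q$ with the same optimum value, together with a polynomial-time procedure converting any feasible solution of $I'$ into a feasible solution of $I$ of no larger size. *)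

(* Defs.v *)
From mathcomp Require Import all_boot all_order all_algebra.
Set Implicit Arguments.
Unset Strict Implicit.
Unset Printing Implicit Defensive.

Definition word := seq bool.

(* Tape symbols are [option bool], with [None] the blank; tapes are infinite
   in both directions. *)
Record tape := Tape { content : int -> option bool; head_pos : int }.

Inductive move := MoveL | Stay | MoveR.

Definition displacement (m : move) : int :=
  match m with MoveL => (- 1)%R | Stay => 0%R | MoveR => 1%R end.

Definition read (t : tape) : option bool := content t (head_pos t).

Definition write_move (a : option bool * move) (t : tape) : tape :=
  Tape (fun z => if z == head_pos t then a.1 else content t z)
       (head_pos t + displacement a.2)%R.

Record machine (k : nat) := Machine {
  state : finType;
  start : state;
  halted : pred state;
  delta : state -> {ffun 'I_k -> option bool} ->
          state * {ffun 'I_k -> option bool * move} }.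

Definition config k (M : machine k) : Type := (state M * ('I_k -> tape))%type.

Definition step k (M : machine k) (c : config M) : config M :=
  if halted c.1 then c
  else let a := delta c.1 [ffun i => read (c.2 i)] in
       (a.1, fun i => write_move (a.2 i) (c.2 i)).

(* [onth w i] is [Some] of the i-th letter of [w], and [None] beyond its end. *)
Definition input_tape (w : word) : tape :=
  Tape (fun z => if z is Posz i then onth w i else None) 0%R.

(* The j-th input word is on tape j; the remaining tapes are blank. *)
Definition init_config k (M : machine k) (ws : seq word) : config M :=
  (start M, fun i : 'I_k => input_tape (nth [::] ws i)).

(* The word that starts under the head and extends to the first blank, with
   only blanks after it, is [w]. *)
Definition tape_holds (t : tape) (w : word) : Prop :=
  forall i : nat, content t (head_pos t + i%:Z)%R = onth w i.

(* The output is read on the last tape. *)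
Definition computes_within k (M : machine k.+1) (ws : seq word) (w : word)
    (T : nat) : Prop :=
  exists t : nat, [/\ t <= T,
    halted (iter t (@step _ M) (init_config M ws)).1 &
    tape_holds ((iter t (@step _ M) (init_config M ws)).2 ord_max) w].

Definition input_size (ws : seq word) : nat := sumn [seq size w | w <- ws].

(* One machine and one polynomial bound serve all [x] in [D]; every polynomial
   in [n] is bounded by some [c * n ^ c + c]. *)
Definition polytime_on (X : Type) (D : X -> Prop)
    (inp : X -> seq word) (out : X -> word) : Prop :=
  exists (k : nat) (M : machine k.+1) (c : nat), forall x : X, D x ->
    computes_within M (inp x) (out x) (c * input_size (inp x) ^ c + c).

Record min_problem := MinProblem {
  instance : Type;
  solution : instance -> Type;
  feasible : forall I : instance, solution I -> Prop;
  cost : forall I : instance, solution I -> nat;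
  enc_instance : instance -> word;
  enc_solution : forall I : instance, solution I -> word }.

Arguments solution _ _ : clear implicits.
Arguments feasible _ [I] _.
Arguments cost _ [I] _.
Arguments enc_instance _ _ : clear implicits.
Arguments enc_solution _ [I] _.

Definition optimum (P : min_problem) (I : instance P) (m : nat) : Prop :=
  (exists2 s : solution P I, feasible P s & cost P s = m) /\
  (forall s : solution P I, feasible P s -> m <= cost P s).

(* The back-conversion [g] is given the source instance together with the
   solution of the transformed instance, on two separate tapes. *)
Definition poly_reducible (P Q : min_problem) : Prop :=
  exists (f : instance P -> instance Q)
         (g : forall I : instance P, solution Q (f I) -> solution P I),
  [/\ polytime_on (fun _ : instance P => True)
        (fun I => [:: enc_instance P I])
        (fun I => enc_instance Q (f I)),
      forall (I : instance P) (m : nat), optimum I m <-> optimum (f I) m,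
      polytime_on (fun x : {I : instance P & solution Q (f I)} =>
                     feasible Q (projT2 x))
        (fun x => [:: enc_instance P (projT1 x); enc_solution Q (projT2 x)])
        (fun x => enc_solution P (g (projT1 x) (projT2 x))) &
      forall (I : instance P) (s : solution Q (f I)), feasible Q s ->
        feasible P (g I s) /\ cost P (g I s) <= cost Q s].

Definition unary (n : nat) : word := rcons (nseq n true) false.

Definition bits n (A : {set 'I_n}) : word := [seq i \in A | i <- enum 'I_n].

(* [(A, v)] stands for A -> v, i.e. for v \/ \/_(a in A) ~ a. *)
Definition horn_clause (n : nat) : Type := ({set 'I_n} * 'I_n)%type.

Record horn_cnf := HornCNF {
  nvars : nat;
  clauses : seq (horn_clause nvars) }.

Definition sat_clause n (a : 'I_n -> bool) (c : horn_clause n) : bool :=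
  a c.2 || [exists x in c.1, ~~ a x].

Definition sat_cnf (F : horn_cnf) (a : 'I_(nvars F) -> bool) : bool :=
  all (sat_clause a) (clauses F).

Definition implied (F : horn_cnf) (c : horn_clause (nvars F)) : Prop :=
  forall a : 'I_(nvars F) -> bool, sat_cnf a -> sat_clause a c.

Definition is_key (F : horn_cnf) (K : {set 'I_(nvars F)}) : Prop :=
  forall u : 'I_(nvars F), u \notin K -> implied (K, u).

Definition enc_horn (F : horn_cnf) : word :=
  unary (nvars F) ++ unary (size (clauses F)) ++
  flatten [seq bits c.1 ++ unary (nat_of_ord c.2) | c <- clauses F].

Definition min_key : min_problem :=
  @MinProblem horn_cnf (fun F => {set 'I_(nvars F)}) is_key
    (fun _ K => #|K|) enc_horn (fun _ K => bits K).

Record tss_instance := TSSInstance {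
  nverts : nat;
  adj : rel 'I_nverts;
  adj_sym : symmetric adj;
  adj_irr : irreflexive adj;
  thr : 'I_nverts -> nat }.

Definition activate (G : tss_instance) (S : {set 'I_(nverts G)}) :
    {set 'I_(nverts G)} :=
  S :|: [set v | thr v <= #|[set w in S | adj v w]|].

Definition is_target_set (G : tss_instance) (S : {set 'I_(nverts G)}) : Prop :=
  exists r : nat, iter r (@activate G) S = [set: 'I_(nverts G)].

(* Adjacency matrix by rows, then the thresholds.  Unary thresholds are no
   restriction: capping a threshold at [nverts G + 1] changes no target set. *)
Definition enc_tss (G : tss_instance) : word :=
  unary (nverts G) ++
  flatten [seq [seq adj v w | w <- enum 'I_(nverts G)]
              | v <- enum 'I_(nverts G)] ++
  flatten [seq unary (thr v) | v <- enum 'I_(nverts G)].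

Definition min_tss : min_problem :=
  @MinProblem tss_instance (fun G => {set 'I_(nverts G)}) is_target_set
    (fun _ S => #|S|) enc_tss (fun _ S => bits S).

(* Main.v *)
From mathcomp Require Import all_boot all_order all_algebra zify.
From Stdlib Require Import FunctionalExtensionality.
Require Import Defs.
Set Implicit Arguments.
Unset Strict Implicit.
Unset Printing Implicit Defensive.

(** The graph has one block per variable [u]: the variable vertex [u], a copy
    [c_(u,j)] of every clause [A_j -> v_j] with its head replaced by [u], and
    [s] carriers adjacent to [u] and to all [c_(u,j)], where [s] is the length
    of the encoded formula.  A carrier has threshold 1, the vertex [u] has
    threshold [s], and [c_(u,j)], which is also adjacent to the variable
    vertices of [A_j], has threshold [|A_j|], plus 1 if [u <> v_j].  Since [s]
    exceeds the number of all clause vertices, activity of the clause vertices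
    that use [u] never activates [u] without a carrier of its block.  So in a
    model that is true at every variable whose block meets the target set, no
    block of a false variable is ever entered, and sending a target set to the
    set of blocks it meets yields a key.

    For the time bounds, programs act on stacks of bits, one per tape, and a
    loop iterates over the letters of a stack that its body leaves alone.  If
    loop bodies push only on stacks of larger index, stack [j] grows in one
    run of a program by a polynomial in the sizes of the stacks below [j], so
    all sizes and the running time are polynomial. *)

(** * Composing machines *)

Section Machines.
Variable k : nat.
Implicit Types (M : machine k) (ts : 'I_k -> tape) (i : 'I_k).

(** Here [t] only bounds the number of steps from above, so time bounds add up under composition and
    can be weakened. *)
Definition reach M (c c' : config M) (t : nat) : Prop :=
  exists2 t', t' <= t & iter t' (@step _ M) c = c'.

Lemma reach_refl M (c : config M) : reach c c 0.
Proof. by exists 0. Qed.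

Lemma reach_step M (c : config M) : reach c (step c) 1.
Proof. by exists 1. Qed.

Lemma reach_trans M (c1 c2 c3 : config M) t t' :
  reach c1 c2 t -> reach c2 c3 t' -> reach c1 c3 (t + t').
Proof.
move=> [a a_le <-] [b b_le <-]; exists (b + a); last by rewrite iterD.
by rewrite addnC leq_add.
Qed.

Lemma reach_leq M (c c' : config M) t t' : t <= t' -> reach c c' t -> reach c c' t'.
Proof. by move=> le_tt' [a a_le <-]; exists a => //; apply: leq_trans le_tt'. Qed.

Definition halts M ts ts' t : Prop :=
  exists2 h, halted h & reach (start M, ts) (h, ts') t.

Lemma reach_embed M M' (e : state M -> state M') :
    (forall s, ~~ halted s -> halted (e s) = false) ->
    (forall s r, ~~ halted s -> delta (e s) r = (e (delta s r).1, (delta s r).2)) ->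
  forall s ts h ts' t, halted h ->
    @reach M (s, ts) (h, ts') t -> @reach M' (e s, ts) (e h, ts') t.
Proof.
move=> eH eD s ts h ts' t hh [a a_le it]; apply: reach_leq a_le _; move: it.
elim: a s ts => [|a IHa] s ts; first by case=> -> ->; apply: reach_refl.
rewrite iterSr {2}/step /=; case: ifPn => [hs | nhs].
  by move/IHa; apply: reach_leq.
move/IHa => r; rewrite -add1n; apply: reach_trans r.
have := @reach_step M' (e s, ts).
by rewrite /step /= eH // eD.
Qed.

Definition idle (r : {ffun 'I_k -> option bool}) : {ffun 'I_k -> option bool * move} :=
  [ffun i => (r i, Stay)].

Lemma write_move_idle (t : tape) : write_move (read t, Stay) t = t.
Proof.
case: t => c h; congr Tape; last by rewrite /= GRing.addr0.
by apply: functional_extensionality => z /=; case: eqP => [->|].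
Qed.

Lemma step_idle ts : (fun i => write_move (idle [ffun j => read (ts j)] i) (ts i)) = ts.
Proof. by apply: functional_extensionality => i; rewrite !ffunE write_move_idle. Qed.

Definition upd ts i (t : tape) : 'I_k -> tape := fun j => if j == i then t else ts j.

Definition act i (a : option bool -> option bool * move) : machine k :=
  @Machine k bool false id
    (fun _ r => (true, [ffun j => if j == i then a (r j) else (r j, Stay)])).

Lemma halts_act i a ts :
  halts (act i a) ts (upd ts i (write_move (a (read (ts i))) (ts i))) 1.
Proof.
exists true => //; rewrite /start /=.
have := @reach_step (act i a) (false, ts); congr reach; rewrite /step /=.
congr pair; apply: functional_extensionality => j; rewrite !ffunE /upd.
by case: eqP => [->|_] //; rewrite write_move_idle.
Qed.

Definition halt : machine k := @Machine k unit tt xpredT (fun s r => (s, idle r)).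

Lemma halts_halt ts : halts halt ts ts 0.
Proof. by exists tt => //; apply: reach_refl. Qed.

Definition seq_machine M1 M2 : machine k :=
  @Machine k (state M1 + state M2)%type (inl (start M1))
    (fun s => if s is inr s2 then halted s2 else false)
    (fun s r => match s with
     | inl s1 => if halted s1 then (inr (start M2), idle r)
                 else (inl (delta s1 r).1, (delta s1 r).2)
     | inr s2 => (inr (delta s2 r).1, (delta s2 r).2)
     end).

Lemma halts_seq M1 M2 ts ts' ts'' t1 t2 :
  halts M1 ts ts' t1 -> halts M2 ts' ts'' t2 ->
  halts (seq_machine M1 M2) ts ts'' (t1 + 1 + t2).
Proof.
move=> [h1 hh1 r1] [h2 hh2 r2]; exists (inr h2) => //.
apply: reach_trans; last first.
  by apply: (@reach_embed M2 (seq_machine M1 M2) inr) r2 => // s /negbTE.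
apply: reach_trans.
  apply: (@reach_embed M1 (seq_machine M1 M2) inl) r1 => // s r /negbTE /= -> //.
have := @reach_step (seq_machine M1 M2) (inl h1, ts').
by rewrite /step /= hh1 /= step_idle.
Qed.

(** The symbol read is kept as the tag of a dependent pair, since each symbol selects a machine with
    its own state type; [None] is the state before the test. *)
Definition case_machine i (M : option bool -> machine k) : machine k :=
  @Machine k (option {o : option bool & state (M o)}) None
    (fun s => if s is Some (existT o s') then @halted _ (M o) s' else false)
    (fun s r => match s with
     | None => (Some (existT _ (r i) (start (M (r i)))), idle r)
     | Some (existT o s') => (Some (existT _ o (delta s' r).1), (delta s' r).2)
     end).

Lemma halts_case i (M : option bool -> machine k) ts ts' t :
  halts (M (read (ts i))) ts ts' t -> halts (case_machine i M) ts ts' (1 + t).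
Proof.
set o := read _ => -[h hh r]; exists (Some (existT _ o h)) => //.
have e : @reach (case_machine i M) (None, ts) (Some (existT _ o (start (M o))), ts) 1.
  have := @reach_step (case_machine i M) (None, ts).
  by rewrite /step /= step_idle ffunE.
apply: reach_trans e _.
apply: (@reach_embed (M o) (case_machine i M) (fun s => Some (existT _ o s))) r => //.
by move=> s /negbTE.
Qed.

(* [inl false] tests the symbol under head [i], [inl true] is the exit. *)
Definition while_machine i M : machine k :=
  @Machine k (bool + state M)%type (inl false)
    (fun s => if s is inl b then b else false)
    (fun s r => match s with
     | inl _ => (if r i is None then inl true else inr (start M), idle r)
     | inr s' => if halted s' then (inl false, idle r)
                 else (inr (delta s' r).1, (delta s' r).2)
     end).

Lemma halts_while_stop i M ts : read (ts i) = None ->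
  halts (while_machine i M) ts ts 1.
Proof.
move=> ri; exists (inl true) => //.
have := @reach_step (while_machine i M) (inl false, ts).
by rewrite /step /= step_idle ffunE ri.
Qed.

Lemma halts_while_next i M ts ts' ts'' t t' : read (ts i) <> None ->
  halts M ts ts' t -> halts (while_machine i M) ts' ts'' t' ->
  halts (while_machine i M) ts ts'' (t.+2 + t').
Proof.
move=> ri [h hh r] [h' hh' r']; exists h' => //.
apply: reach_trans r'; rewrite -[t.+2]addn1 -add1n.
apply: (@reach_trans (while_machine i M) _ (inr h, ts')); last first.
  have := @reach_step (while_machine i M) (inr h, ts').
  by rewrite /step /= hh /= step_idle.
apply: (@reach_trans (while_machine i M) _ (inr (start M), ts)).
  have := @reach_step (while_machine i M) (inl false, ts).
  by rewrite /step /= step_idle ffunE; case: (read _) ri.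
apply: (@reach_embed M (while_machine i M) inr) r => // s r'' /negbTE /= -> //.
Qed.

End Machines.

(** * Loop programs on stacks *)

(** [Case] tests the top of a stack, with [None] for an empty one. Branches and loop bodies are
    functions of the letter, so the letter is built into the program text and occupies no
    register. *)
Inductive cmd :=
  | Skip
  | Push of nat & bool
  | Pop of nat
  | Seq of cmd & cmd
  | Case of nat & (option bool -> cmd)
  | For of nat & (bool -> cmd).

Definition reg (s : seq word) (i : nat) : word := nth [::] s i.

(** A loop runs over the contents of its register at entry. A machine scanning the tape agrees with
    this because [wf] forbids the body to touch that register. *)
Fixpoint den (p : cmd) (s : seq word) : seq word :=
  match p with
  | Skip => s
  | Push i b => set_nth [::] s i (b :: reg s i)
  | Pop i => set_nth [::] s i (behead (reg s i))
  | Seq p q => den q (den p s)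
  | Case i p => den (p (ohead (reg s i))) s
  | For i p => foldl (fun s b => den (p b) s) s (reg s i)
  end.

Fixpoint touched (p : cmd) : seq nat :=
  match p with
  | Skip => [::]
  | Push i _ | Pop i => [:: i]
  | Seq p q => touched p ++ touched q
  | Case i p => i :: touched (p None) ++ touched (p (Some true)) ++ touched (p (Some false))
  | For i p => i :: touched (p true) ++ touched (p false)
  end.

Fixpoint pushed (p : cmd) : seq nat :=
  match p with
  | Skip | Pop _ => [::]
  | Push i _ => [:: i]
  | Seq p q => pushed p ++ pushed q
  | Case i p => pushed (p None) ++ pushed (p (Some true)) ++ pushed (p (Some false))
  | For i p => pushed (p true) ++ pushed (p false)
  end.

(* The body of a loop pushes only on registers above the loop register: this
   is what keeps register sizes polynomial. *)
Fixpoint wf (k : nat) (p : cmd) : bool :=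
  match p with
  | Skip => true
  | Push i _ | Pop i => i < k
  | Seq p q => wf k p && wf k q
  | Case i p => [&& i < k, wf k (p None), wf k (p (Some true)) & wf k (p (Some false))]
  | For i p => [&& i < k, wf k (p true), wf k (p false),
                   i \notin touched (p true) ++ touched (p false) &
                   all (ltn i) (pushed (p true) ++ pushed (p false))]
  end.

(** Bounds the steps of the compiled machine. In a loop, 8 per letter is 5 for the control of a
    round and 3 for walking back over the letter; 7 pays for two loop exits, two single moves and
    three transitions. *)
Fixpoint cost (p : cmd) (s : seq word) : nat :=
  match p with
  | Skip => 0
  | Push _ _ => 3
  | Pop _ => 1
  | Seq p q => cost p s + 1 + cost q (den p s)
  | Case i p => 1 + cost (p (ohead (reg s i))) s
  | For i p =>
      (fix loop s w := if w is b :: w' then cost (p b) s + 8 + loop (den (p b) s) w'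
                       else 7) s (reg s i)
  end.

Lemma den_untouched p s j : j \notin touched p -> reg (den p s) j = reg s j.
Proof.
elim: p s => [|i b|i| p IHp q IHq | i p IHp | i p IHp] s //=.
- by rewrite /reg inE nth_set_nth /= => /negbTE ->.
- by rewrite /reg inE nth_set_nth /= => /negbTE ->.
- by rewrite mem_cat negb_or => /andP[jp jq]; rewrite IHq ?IHp.
- rewrite inE !mem_cat !negb_or => /and4P[_ j0 j1 j2].
  by apply: IHp; case: (ohead _) => [[]|].
- rewrite inE mem_cat !negb_or => /and3P[_ j1 j2].
  by move: (reg s i) => w; elim: w s => //= b w IHw s; rewrite IHw IHp //; case: b.
Qed.

Lemma size_unpushed p s j : j \notin pushed p -> size (reg (den p s) j) <= size (reg s j).
Proof.
elim: p s => [|i b|i| p IHp q IHq | i p IHp | i p IHp] s //=.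
- by rewrite /reg inE nth_set_nth /= => /negbTE ->.
- move=> _; rewrite /reg nth_set_nth /=; by case: eqP => // ->; rewrite size_behead leq_pred.
- rewrite mem_cat negb_or => /andP[jp jq].
  by apply: leq_trans (IHq _ jq) (IHp _ jp).
- rewrite !mem_cat !negb_or => /and3P[j0 j1 j2].
  by apply: IHp; case: (ohead _) => [[]|].
- rewrite mem_cat !negb_or => /andP[j1 j2].
  move: (reg s i) => w; elim: w s => //= b w IHw s; apply: leq_trans (IHw _) _.
  by apply: IHp; case: b.
Qed.

Lemma onth_ohead_drop (w : word) j : onth w j = ohead (drop j w).
Proof. by elim: w j => [|b w IHw] [|j] //=. Qed.

(** * Compilation of loop programs to Turing machines *)

Section Compile.
Variable k : nat.
Implicit Types (ts : 'I_k.+1 -> tape).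

(** The top of a stack lies under the head and the rest to its right. A loop walks right along its
    word, running the body at each letter up to the first blank, then walks back to the blank left
    of the word and steps right, which restores the head. *)
Fixpoint compile (p : cmd) : machine k.+1 :=
  match p with
  | Skip => halt k.+1
  | Push i b => seq_machine (act (inord i) (fun a => (a, MoveL)))
                            (act (inord i) (fun _ => (Some b, Stay)))
  | Pop i => act (inord i) (fun _ => (None, MoveR))
  | Seq p q => seq_machine (compile p) (compile q)
  | Case i p => case_machine (inord i) (fun o => compile (p o))
  | For i p =>
      let step m := act (inord i) (fun a => (a, m)) in
      seq_machine
        (while_machine (inord i)
           (seq_machine
              (case_machine (inord i)
                 (fun o => if o is Some b then compile (p b) else halt k.+1))
              (step MoveR)))
        (seq_machine (step MoveL)
           (seq_machine (while_machine (inord i) (step MoveL)) (step MoveR)))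
  end.

(** Blanks are also required left of the head: they stop the walk back at the end of a loop. *)
Definition holds (t : tape) (w : word) : Prop :=
  forall z : int, content t (head_pos t + z)%R = if z is Posz j then onth w j else None.

Definition shift (t : tape) (z : int) : tape := Tape (content t) (head_pos t + z)%R.

Lemma write_move_shift (t : tape) m :
  write_move (read t, m) t = shift t (displacement m).
Proof.
case: t => c h; congr Tape => /=.
by apply: functional_extensionality => z /=; case: eqP => [->|].
Qed.

Lemma shift_shift t y z : shift (shift t y) z = shift t (y + z)%R.
Proof. by congr Tape; rewrite /= GRing.addrA. Qed.

Lemma shift0 t : shift t 0%R = t.
Proof. by case: t => c h; congr Tape; rewrite /= GRing.addr0. Qed.

Lemma read_shift t w (j : nat) : holds t w -> read (shift t j) = onth w j.
Proof. by move=> /(_ (Posz j)). Qed.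

Lemma read_holds t w : holds t w -> read t = ohead w.
Proof. by move=> /(_ 0%R); rewrite GRing.addr0 /read => ->; case: w. Qed.

Lemma holds_push t w b :
  holds t w -> holds (write_move (Some b, Stay) (shift t (- 1)%R)) (b :: w).
Proof.
move=> tw z; rewrite /write_move /= GRing.addr0.
have [->|nz] := eqVneq z 0%R; first by rewrite GRing.addr0 eqxx.
rewrite (_ : (_ == _) = false); last by apply/negbTE; lia.
have := tw (z - 1)%R; rewrite (_ : head_pos t + (z - 1) = head_pos t - 1 + z)%R; last by lia.
move=> ->; case: z nz => [[|j]|j] // _.
  by rewrite (_ : (Posz j.+1 - 1)%R = Posz j) //; lia.
Qed.

Lemma holds_pop t w : holds t w -> holds (write_move (None, MoveR) t) (behead w).
Proof.
move=> tw z; rewrite /write_move /=.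
have [->|nz] := eqVneq z (- 1)%R; first by rewrite GRing.addrK eqxx.
rewrite (_ : (_ == _) = false); last by apply/negbTE; lia.
have := tw (1 + z)%R; rewrite GRing.addrA => ->.
case: z nz => [j|[|j]] // _.
  by rewrite (_ : (1 + Posz j)%R = Posz j.+1) //; case: w {tw} => //= ; case: j.
Qed.

(** Restricting to [A] allows a tape to be left out: inside a loop, the head of the loop register
    stands within its word and [holds] may fail there. *)
Definition rep (A : pred nat) (s : seq word) ts : Prop :=
  forall i : 'I_k.+1, A i -> holds (ts i) (reg s i).

Lemma halts_step (i : 'I_k.+1) m ts :
  halts (act i (fun a => (a, m))) ts (upd ts i (shift (ts i) (displacement m))) 1.
Proof. by rewrite -write_move_shift; apply: halts_act. Qed.

Lemma upd_id ts i : upd ts i (ts i) = ts.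
Proof. by apply: functional_extensionality => j; rewrite /upd; case: eqP => [->|]. Qed.

Lemma upd_upd ts i t t' : upd (upd ts i t) i t' = upd ts i t'.
Proof. by apply: functional_extensionality => j; rewrite /upd; case: eqP. Qed.

Lemma upd_eq ts i t : upd ts i t i = t.
Proof. by rewrite /upd eqxx. Qed.

Lemma halts_rewind (i : 'I_k.+1) t w ts (j : nat) : holds t w -> j <= size w ->
  halts (while_machine i (act i (fun a => (a, MoveL))))
    (upd ts i (shift t (Posz j - 1)%R)) (upd ts i (shift t (- 1)%R)) (3 * j).+1.
Proof.
move=> tw; elim: j => [_|j IHj ltj].
  rewrite GRing.add0r muln0; apply: halts_while_stop.
  by rewrite upd_eq; have := tw (- 1)%R; rewrite /read.
have -> : (Posz j.+1 - 1)%R = Posz j by lia.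
rewrite (_ : (3 * j.+1).+1 = 1.+2 + (3 * j).+1); last by lia.
apply: halts_while_next _ (IHj (ltnW ltj)).
  rewrite upd_eq (read_shift _ tw) => e.
  by move: ltj; rewrite -onthTE e.
have := halts_step i MoveL (upd ts i (shift t j)).
by rewrite upd_upd upd_eq shift_shift.
Qed.

(** Untouched tapes are preserved with their heads, not only as words; this keeps the head of a loop
    register on the current letter while the body runs. *)
Lemma compile_ok p : wf k.+1 p -> forall (A : pred nat) s ts,
  (forall i, i \in touched p -> A i) -> rep A s ts ->
  exists ts', [/\ halts (compile p) ts ts' (cost p s), rep A (den p s) ts' &
    forall i : 'I_k.+1, (i : nat) \notin touched p -> ts' i = ts i].
Proof.
elim: p => [||| p IHp q IHq | i p IHp | i p IHp] /=.
- by move=> _ A s ts _ r; exists ts; split=> //; apply: halts_halt.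
- move=> i b lti A s ts tA r.
  have Ai : A i by apply: tA; rewrite inE.
  have ri : holds (ts (inord i)) (reg s i) by have := r (inord i); rewrite inordK //; apply.
  eexists; split.
  + by apply: (halts_seq (halts_step _ _ _)); apply: halts_act.
  + move=> j Aj; rewrite upd_upd upd_eq /reg nth_set_nth /= {1}/upd -(inj_eq val_inj) /= inordK //.
    by case: eqP => [_|_]; [apply: holds_push | apply: r].
  + move=> j; rewrite inE /upd -(inj_eq val_inj) /= inordK // => /negbTE -> //.
- move=> i lti A s ts tA r.
  have Ai : A i by apply: tA; rewrite inE.
  have ri : holds (ts (inord i)) (reg s i) by have := r (inord i); rewrite inordK //; apply.
  eexists; split; first exact: halts_act.
  + move=> j Aj; rewrite /reg nth_set_nth /= {1}/upd -(inj_eq val_inj) /= inordK //.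
    by case: eqP => [_|_]; [apply: holds_pop | apply: r].
  + move=> j; rewrite inE /upd -(inj_eq val_inj) /= inordK // => /negbTE -> //.
- move=> /andP[wp wq] A s ts tA r.
  have [|ts1 [h1 r1 u1]] := IHp wp A s ts _ r.
    by move=> i ip; apply: tA; rewrite mem_cat ip.
  have [|ts2 [h2 r2 u2]] := IHq wq A _ _ _ r1.
    by move=> i iq; apply: tA; rewrite mem_cat iq orbT.
  exists ts2; split=> //; first exact: halts_seq h1 h2.
  by move=> i; rewrite mem_cat negb_or => /andP[ip iq]; rewrite u2 ?u1.
- move=> /and4P[lti w0 w1 w2] A s ts tA r.
  have Ai : A i by apply: tA; rewrite inE eqxx.
  have ri : holds (ts (inord i)) (reg s i) by have := r (inord i); rewrite inordK //; apply.
  set o := ohead _.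
  have sub j : j \in touched (p o) ->
      j \in touched (p None) ++ touched (p (Some true)) ++ touched (p (Some false)).
    by rewrite !mem_cat; case: (o) => [[]|] ->; rewrite ?orbT.
  have wo : wf k.+1 (p o) by case: (o) => [[]|].
  have [|ts1 [h1 r1 u1]] := IHp o wo A s ts _ r.
    by move=> j jp; apply: tA; rewrite inE sub ?orbT.
  exists ts1; split=> //; first by apply: halts_case; rewrite (read_holds ri).
  move=> j; rewrite inE negb_or => /andP[_]; move/(contra (@sub j)); exact: u1.
move=> /and5P[lti wt wf' + _] A s ts tA r.
set B := touched _ ++ _ => iB.
have wb b : wf k.+1 (p b) by case: b.
have sub b j : j \in touched (p b) -> j \in B by rewrite mem_cat; case: b => ->; rewrite ?orbT.
have Ai : A i by apply: tA; rewrite inE eqxx.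
have ri : holds (ts (inord i)) (reg s i) by have := r (inord i); rewrite inordK //; apply.
set W := reg s i in ri *.
pose A' : pred nat := fun j => A j && (j != i).
pose at_ ts' (j : nat) : 'I_k.+1 -> tape := upd ts' (inord i) (shift (ts (inord i)) j).
have eqI (j : 'I_k.+1) : (j == inord i) = (j == i :> nat).
  by rewrite -(inj_eq val_inj) /= inordK.
pose body := seq_machine (case_machine (inord i)
  (fun o => if o is Some b then compile (p b) else halt k.+1)) (act (inord i) (fun a => (a, MoveR))).
pose loopc := fix loop s w := if w is b :: w' then cost (p b) s + 5 + loop (den (p b) s) w' else 1.
have loop w : forall j s' ts', drop j W = w -> j + size w = size W -> rep A' s' ts' ->
  exists ts'', [/\ halts (while_machine (inord i) body) (at_ ts' j) (at_ ts'' (size W)) (loopc s' w),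
    rep A' (foldl (fun s b => den (p b) s) s' w) ts'' &
    forall j : 'I_k.+1, (j : nat) \notin B -> j != i :> nat -> ts'' j = ts' j].
  elim: w => [|b w IHw] j s' ts' dw jw r'.
    exists ts'; split=> //=; rewrite addn0 in jw; rewrite jw.
    by apply: halts_while_stop; rewrite /at_ upd_eq (read_shift _ ri) onth_default.
  have rd ts0 : read (at_ ts0 j (inord i)) = Some b.
    by rewrite /at_ upd_eq (read_shift _ ri) onth_ohead_drop dw.
  have [||ts1 [h1 r1 u1]] := IHp b (wb b) A' s' (at_ ts' j).
  - move=> l lb; rewrite /A' tA ?inE ?(sub _ _ lb) ?orbT //=.
    by apply: contraNneq iB => <-; apply: sub lb.
  - move=> l Al; rewrite /at_ /upd eqI; move: (Al); rewrite /A' => /andP[_ /negbTE ->].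
    exact: r'.
  (* The body does not touch register [i], so that head is still on letter [j]. *)
  have e1 : ts1 = at_ ts1 j.
    apply: functional_extensionality => l; rewrite /at_ /upd eqI; case: eqP => // li.
    rewrite u1; first by rewrite /at_ /upd eqI li eqxx.
    by rewrite li; apply: contra iB; apply: sub.
  have [|||ts2 [h2 r2 u2]] := IHw j.+1 (den (p b) s') ts1 => //.
  - by rewrite -addn1 addnC -drop_drop dw /= drop0.
  - by move: jw => /=; lia.
  exists ts2; split=> //.
    rewrite /= (_ : cost (p b) s' + 5 = (1 + cost (p b) s' + 1 + 1).+2); last by lia.
    apply: halts_while_next h2; first by rewrite rd.
    apply: halts_seq; first by apply: halts_case; rewrite rd; apply: h1.
    have := halts_step (inord i) MoveR ts1; rewrite {2 3}e1 /at_ upd_upd upd_eq shift_shift.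
    by rewrite (_ : (Posz j + displacement MoveR)%R = Posz j.+1) //=; lia.
  move=> l lB li; rewrite u2 // u1; last by apply: contra lB; apply: sub.
  by rewrite /at_ /upd eqI (negbTE li).
have [|||ts1 [h1 r1 u1]] := loop W 0 s ts.
- by rewrite drop0.
- by [].
- by move=> l /andP[Al _]; apply: r.
have at0 : at_ ts 0 = ts by rewrite /at_ shift0 upd_id.
rewrite at0 in h1.
have : cost (For i p) s = loopc s W + 1 + (1 + 1 + ((3 * size W).+1 + 1 + 1)).
  rewrite /= -/W; elim: W (s) {ri h1 r1 loop at_ at0} => //= b w IHw s'.
  by rewrite IHw; lia.
rewrite /= -/W => ->.
exists (upd ts1 (inord i) (ts (inord i))); split.
- apply: halts_seq; first exact: h1.
  apply: halts_seq; first exact: halts_step.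
  rewrite /at_ upd_upd upd_eq shift_shift.
  apply: halts_seq; first by apply: halts_rewind ri _.
  have := halts_step (inord i) MoveR (upd ts1 (inord i) (shift (ts (inord i)) (- 1)%R)).
  by rewrite upd_upd upd_eq shift_shift shift0.
- move=> l Al; rewrite {1}/upd eqI; case: eqP => [->|/eqP li].
    have -> // : reg (foldl (fun s b => den (p b) s) s W) i = reg s i.
    elim: (W) (s) => //= b w IHw s'; rewrite IHw den_untouched //.
    by apply: contra iB; apply: sub.
  by apply: r1; rewrite /A' Al.
- move=> l; rewrite inE negb_or => /andP[li lB].
  by rewrite {1}/upd eqI (negbTE li) u1.
Qed.
End Compile.

(** * Loop programs run in polynomial time *)

Inductive npoly : (nat -> nat) -> Prop :=
  | NConst c : npoly (fun _ => c)
  | NId : npoly (fun x => x)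
  | NAdd f g : npoly f -> npoly g -> npoly (fun x => f x + g x)
  | NMul f g : npoly f -> npoly g -> npoly (fun x => f x * g x).

Lemma npoly_comp f g : npoly f -> npoly g -> npoly (fun x => f (g x)).
Proof.
move=> pf pg; elim: pf => [c||f1 f2 _ p1 _ p2|f1 f2 _ p1 _ p2] //; first exact: NConst.
  exact: NAdd.
exact: NMul.
Qed.

Lemma npoly_mono f : npoly f -> {homo f : x y / x <= y}.
Proof.
elim=> [c||f1 f2 _ p1 _ p2|f1 f2 _ p1 _ p2] x y xy //; first by rewrite leq_add ?p1 ?p2.
by rewrite leq_mul ?p1 ?p2.
Qed.

Lemma npoly_bound f : npoly f -> exists c, forall x, f x <= c * x ^ c + c.
Proof.
(* The base [x.+1] is positive, so powers grow with the exponent, and sums and products of two such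
   bounds have a bound of the same form. *)
move=> pf; suff [c fc] : exists c, forall x, f x <= c * x.+1 ^ c.
  exists (c * 2 ^ c) => x; apply: leq_trans (fc x) _.
  have le_c : c <= c * 2 ^ c by rewrite leq_pmulr ?expn_gt0.
  case: x => [|x]; first by rewrite exp1n muln1 addnC; apply: leq_trans le_c (leq_addr _ _).
  apply: leq_trans (leq_addr _ _); rewrite -mulnA leq_mul2l; apply/orP; right.
  apply: (@leq_trans ((2 * x.+1) ^ c)); first by case: (c) => // c'; rewrite leq_exp2r //; lia.
  by rewrite expnMn leq_mul2l leq_pexp2l ?orbT.
elim: pf => [c||f1 f2 _ [c1 p1] _ [c2 p2]|f1 f2 _ [c1 p1] _ [c2 p2]].
- by exists c => x; rewrite leq_pmulr ?expn_gt0.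
- by exists 1 => x; rewrite expn1 mul1n.
- exists (c1 + c2) => x; apply: leq_trans (leq_add (p1 x) (p2 x)) _.
  by rewrite mulnDl leq_add // leq_mul2l leq_pexp2l ?orbT ?leq_addl ?leq_addr.
- exists (c1 + c2 + c1 * c2) => x; apply: leq_trans (leq_mul (p1 x) (p2 x)) _.
  by rewrite mulnACA -expnD leq_mul ?leq_addl ?leq_pexp2l ?leq_addr.
Qed.

Definition mass (j : nat) (s : seq word) : nat := \sum_(i < j) size (reg s i).

Lemma mass_recr j s : mass j.+1 s = mass j s + size (reg s j).
Proof. exact: big_ord_recr. Qed.

Lemma leq_mass i j s : i <= j -> mass i s <= mass j s.
Proof.
move=> /subnKC <-; elim: (j - i) => [|d IHd]; first by rewrite addn0.
by rewrite addnS mass_recr; apply: leq_trans IHd (leq_addr _ _).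
Qed.

Lemma size_leq_mass i j s : i < j -> size (reg s i) <= mass j s.
Proof. by move=> ij; apply: leq_trans (leq_mass s ij); rewrite mass_recr leq_addl. Qed.

(* Bounds [mass j] along at most [x] rounds of a step that lengthens each
   register [l] by at most [Q (mass l)], starting from mass at most [x]. *)
Definition loop_bound (Q : nat -> nat) (j x : nat) : nat :=
  iter j (fun y => y + (x + x * Q y)) 0.

Lemma npoly_loop_bound Q j : npoly Q -> npoly (loop_bound Q j).
Proof.
move=> pQ; elim: j => [|j IHj]; first exact: NConst.
apply: (NAdd IHj); apply: (NAdd NId); apply: (NMul NId).
exact: npoly_comp pQ IHj.
Qed.

Lemma leq_loop_bound Q i j x : i <= j -> loop_bound Q i x <= loop_bound Q j x.
Proof.
move=> /subnKC <-; elim: (j - i) => [|d IHd]; first by rewrite addn0.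
by rewrite addnS; apply: leq_trans IHd _; rewrite /loop_bound iterS leq_addr.
Qed.

(** * Growth of registers along a loop *)

Section LoopGrowth.
Variables (k : nat) (D : bool -> seq word -> seq word) (Q : nat -> nat).
Hypothesis Qmono : {homo Q : x y / x <= y}.
Hypothesis DQ : forall b s j, j < k ->
  size (reg (D b s) j) <= size (reg s j) + Q (mass j s).

Let loop s w := foldl (fun s b => D b s) s w.

Lemma size_loop s j y x w : j < k ->
    (forall w, size w <= x -> mass j (loop s w) <= y) -> size w <= x ->
  size (reg (loop s w) j) <= size (reg s j) + size w * Q y.
Proof.
move=> jk Hy; elim/last_ind: w => [|w b IHw]; first by rewrite mul0n addn0.
rewrite size_rcons => wx; rewrite /loop foldl_rcons -/(loop s w).
apply: leq_trans (DQ _ _ jk) _; have := IHw (ltnW wx).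
have := Qmono (Hy w (ltnW wx)); rewrite mulSn; lia.
Qed.

(** By induction on [j]: a bound on the registers below [j] that is valid in every round limits what
    a round adds to register [j], and there are at most [x] rounds. *)
Lemma mass_loop s j x : j <= k -> mass j s <= x -> forall w, size w <= x ->
  mass j (loop s w) <= loop_bound Q j x.
Proof.
elim: j => [|j IHj] jk; first by rewrite /mass => _ w _; rewrite big_ord0.
move=> mx w wx; have mjx : mass j s <= x by apply: leq_trans (leq_mass _ _) mx.
rewrite mass_recr; apply: leq_add; first by apply: IHj (ltnW jk) mjx w wx.
apply: leq_trans (size_loop jk (IHj (ltnW jk) mjx) wx) _.
rewrite leq_add ?leq_mul //.
by apply: leq_trans mx; rewrite mass_recr leq_addl.
Qed.

End LoopGrowth.

(** Growth of register [j] is charged to the registers strictly below it. This survives nesting: a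
    loop whose body pushes on [j] runs over a register below [j], so it has at most [mass j s]
    rounds. *)
Lemma den_growth k p : wf k p -> exists2 Q, npoly Q &
  forall s j, j < k -> size (reg (den p s) j) <= size (reg s j) + Q (mass j s).
Proof.
elim: p => [|i b|i|p IHp q IHq|i p IHp|i p IHp] /=.
- by exists (fun=> 0); [apply: NConst | move=> *; apply: leq_addr].
- exists (fun=> 1); first exact: NConst.
  by move=> s j _; rewrite /reg nth_set_nth /=; case: eqP => [->|_] /=; rewrite ?addn1 ?leq_addr.
- exists (fun=> 0); first exact: NConst.
  move=> s j _; rewrite addn0.
  exact: (@size_unpushed (Pop i)).
- move=> /andP[/IHp[P pP HP] /IHq[R pR HR]].
  (* [H x] bounds [mass j] after [p] if it was [x] before: each of fewer than [k] registers grows by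
     at most [P x]. *)
  pose H x := x + k * P x; have pH : npoly H by apply: (NAdd NId); exact: (NMul (NConst k) pP).
  exists (fun x => P x + R (H x)); first by apply: (NAdd pP); apply: npoly_comp.
  move=> s j jk; apply: leq_trans (HR _ _ jk) _.
  rewrite addnA leq_add ?HP //; apply: (npoly_mono pR).
  apply: (@leq_trans (\sum_(i < j) (size (reg s i) + P (mass j s)))).
    apply: leq_sum => i _; apply: leq_trans (HP _ _ (ltn_trans (ltn_ord i) jk)) _.
    by rewrite leq_add2l; apply: (npoly_mono pP); apply: leq_mass (ltnW _).
  by rewrite big_split /= sum_nat_const card_ord /H leq_add2l leq_mul // ltnW.
- move=> /and4P[_ /IHp[P0 pP0 H0] /IHp[P1 pP1 H1] /IHp[P2 pP2 H2]].
  exists (fun x => P0 x + (P1 x + P2 x)); first by do !apply: NAdd.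
  move=> s j jk; case: (ohead _) => [[]|].
  + by have := H1 s j jk; lia.
  + by have := H2 s j jk; lia.
  + by have := H0 s j jk; lia.
move=> /and5P[ik /IHp[P1 pP1 H1] /IHp[P2 pP2 H2] _ /allP iB].
pose Q x := P1 x + P2 x; have pQ : npoly Q by apply: NAdd.
exists (fun x => x * Q (loop_bound Q k x)).
  by apply: (NMul NId); apply: (npoly_comp pQ); apply: npoly_loop_bound.
move=> s j jk.
have [ji | nji] := boolP (j \in pushed (p true) ++ pushed (p false)); last first.
  by apply: leq_trans (leq_addr _ _); apply: (@size_unpushed (For i p)).
have {ji} ij := iB _ ji.
have DQ b s' l : l < k -> size (reg (den (p b) s') l) <= size (reg s' l) + Q (mass l s').
  move=> lk; rewrite /Q; case: b; first by have := H1 s' l lk; lia.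
  by have := H2 s' l lk; lia.
have mQ := npoly_mono pQ; have wx := size_leq_mass s ij.
apply: leq_trans (size_loop mQ DQ jk (mass_loop mQ DQ (ltnW jk) (leqnn _)) wx) _.
rewrite leq_add2l leq_mul // mQ //; exact: leq_loop_bound (ltnW jk).
Qed.

Lemma den_mass k p : wf k p -> exists2 P, npoly P & forall s, mass k (den p s) <= P (mass k s).
Proof.
move=> /den_growth[Q pQ HQ]; exists (fun x => x + k * Q x).
  by apply: (NAdd NId); exact: (NMul (NConst k) pQ).
move=> s; apply: (@leq_trans (\sum_(i < k) (size (reg s i) + Q (mass k s)))).
  apply: leq_sum => i _; apply: leq_trans (HQ _ _ (ltn_ord i)) _.
  by rewrite leq_add2l; apply: (npoly_mono pQ); apply: leq_mass (ltnW _).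
by rewrite big_split /= sum_nat_const card_ord.
Qed.

Lemma cost_poly k p : wf k p -> exists2 T, npoly T & forall s, cost p s <= T (mass k s).
Proof.
elim: p => [|i b|i|p IHp q IHq|i p IHp|i p IHp] /=.
- by exists (fun=> 0); first exact: NConst.
- by exists (fun=> 3); first exact: NConst.
- by exists (fun=> 1); first exact: NConst.
- move=> /andP[wp /IHq[U pU HU]]; have [T pT HT] := IHp wp; have [P pP HP] := den_mass wp.
  exists (fun x => T x + 1 + U (P x)).
    by apply: NAdd; [exact: (NAdd pT (NConst 1)) | apply: npoly_comp].
  move=> s; rewrite !leq_add //; apply: leq_trans (HU _) _; exact: npoly_mono.
- move=> /and4P[_ /IHp[P0 pP0 H0] /IHp[P1 pP1 H1] /IHp[P2 pP2 H2]].
  exists (fun x => 1 + (P0 x + (P1 x + P2 x))).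
    by apply: (NAdd (NConst 1)); do !apply: NAdd.
  move=> s; rewrite leq_add2l; case: (ohead _) => [[]|].
  + by have := H1 s; lia.
  + by have := H2 s; lia.
  + by have := H0 s; lia.
move=> /and5P[ik w1 w2 _ _].
have [P1 pP1 H1] := den_growth w1; have [P2 pP2 H2] := den_growth w2.
have [T1 pT1 G1] := IHp _ w1; have [T2 pT2 G2] := IHp _ w2.
pose Q x := P1 x + P2 x; have pQ : npoly Q by apply: NAdd.
pose T x := T1 x + T2 x; have pT : npoly T by apply: NAdd.
have DQ b s' l : l < k -> size (reg (den (p b) s') l) <= size (reg s' l) + Q (mass l s').
  move=> lk; rewrite /Q; case: b; first by have := H1 s' l lk; lia.
  by have := H2 s' l lk; lia.
have mQ := npoly_mono pQ.
exists (fun x => x * (T (loop_bound Q k x) + 8) + 7).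
  apply: (fun h => NAdd h (NConst 7)); apply: (NMul NId); apply: (fun h => NAdd h (NConst 8)).
  by apply: (npoly_comp pT); apply: npoly_loop_bound.
move=> s; have wx := size_leq_mass s ik; set x := mass k s in wx *.
have bound v : size v <= x -> mass k (foldl (fun s b => den (p b) s) s v) <= loop_bound Q k x.
  exact: (mass_loop mQ DQ (leqnn k) (leqnn _)).
set W := reg s i in wx *; apply: (@leq_trans (size W * (T (loop_bound Q k x) + 8) + 7)); last first.
  by rewrite leq_add2r leq_mul.
(* Generalizing over the prefix [v] already processed covers every intermediate state of the loop,
   where [bound] limits the mass. *)
suff loop w v : size v + size w <= x ->
    (fix loop s w := if w is b :: w' then cost (p b) s + 8 + loop (den (p b) s) w' else 7)
      (foldl (fun s b => den (p b) s) s v) w <= size w * (T (loop_bound Q k x) + 8) + 7.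
  exact: (loop W [::]).
elim: w v => [|b w IHw] v //= vw.
have := IHw (rcons v b); rewrite foldl_rcons size_rcons addSnnS => /(_ vw) IH.
have vx : size v <= x by lia.
have cb : cost (p b) (foldl (fun s b => den (p b) s) s v) <= T (loop_bound Q k x).
  apply: leq_trans (npoly_mono pT (bound _ vx)); rewrite /T.
  by case: (b); [apply: leq_trans (leq_addr _ _) | apply: leq_trans (leq_addl _ _)].
by rewrite mulSn -[leqRHS]addnA leq_add // leq_add2r.
Qed.

(** The [d] empty registers change no value of [reg]; they give the initial state an explicit
    length, so that programs can be evaluated symbolically. Register [k] is the last tape, where the
    output is read. *)
Lemma polytime_den k d p (X : Type) (D : X -> Prop) (inp : X -> seq word) (out : X -> word) :
    wf k.+1 p ->
    (forall x, D x -> reg (den p (inp x ++ nseq d [::])) k = out x) ->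
  polytime_on D inp out.
Proof.
move=> wp outE; have [T pT HT] := cost_poly wp; have [c Tc] := npoly_bound pT.
exists k, (compile k p), c => x Dx; set s := inp x ++ nseq d [::].
have regE j : reg s j = nth [::] (inp x) j.
  by rewrite /reg nth_cat nth_nseq; case: ltnP => // h; rewrite if_same nth_default.
have [||ts' [[h hh [t t_le tE]] r' _]] :=
    @compile_ok k p wp predT s (fun i => input_tape (nth [::] (inp x) i)).
- by [].
- by move=> i _ z; rewrite regE /= GRing.add0r.
exists t; split.
- apply: leq_trans t_le _; apply: leq_trans (HT _) _; apply: leq_trans (Tc _) _.
  rewrite leq_add2r leq_mul2l; apply/orP; right.
  suff m_le : mass k.+1 s <= input_size (inp x) by case: (c) => // c'; rewrite leq_exp2r.
  rewrite /mass (eq_bigr (fun i : 'I__ => size (nth [::] (inp x) i))); last by move=> i _; rewrite regE.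
  rewrite /input_size; elim: (inp x) k.+1 => [|w ws IH] [|n] /=; rewrite ?big_ord0 //.
    by rewrite big1 // => i _; rewrite nth_nil.
  by rewrite big_ord_recl /= leq_add2l; apply: leq_trans (IH n).
- by rewrite /init_config tE.
- rewrite /init_config tE /= -outE // => i.
  by have := r' ord_max isT (Posz i).
Qed.

(** * The graph of a Horn formula *)

Lemma nth_bits n (A : {set 'I_n}) (u : 'I_n) : nth false (bits A) u = (u \in A).
Proof. by rewrite (nth_map u) ?size_enum_ord // nth_ord_enum. Qed.

Lemma size_bits n (A : {set 'I_n}) : size (bits A) = n.
Proof. by rewrite size_map size_enum_ord. Qed.

Lemma count_bits n (A : {set 'I_n}) : count id (bits A) = #|A|.
Proof. by rewrite [RHS]cardE {1}/enum_mem size_filter count_map enumT. Qed.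

Section Blocks.
Variables n b : nat.

Lemma blk_subproof (i : 'I_(n * b.+1)) : i %/ b.+1 < n.
Proof. by rewrite ltn_divLR. Qed.

Definition blk (i : 'I_(n * b.+1)) : 'I_n := Ordinal (blk_subproof i).

Lemma vx_subproof (u : 'I_n) (x : 'I_b.+1) : u * b.+1 + x < n * b.+1.
Proof. by rewrite -ltn_divLR // divnMDl // divn_small // addn0. Qed.

Definition vx (u : 'I_n) (x : 'I_b.+1) : 'I_(n * b.+1) := Ordinal (vx_subproof u x).

Lemma vx_div u x : vx u x %/ b.+1 = u.
Proof. by rewrite /= divnMDl // divn_small // addn0. Qed.

Lemma vx_mod u x : vx u x %% b.+1 = x.
Proof. by rewrite /= modnMDl modn_small. Qed.

Lemma blk_vx u x : blk (vx u x) = u.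
Proof. by apply: val_inj; apply: vx_div. Qed.

Lemma vx_inj u x u' x' : vx u x = vx u' x' -> u = u' /\ x = x'.
Proof.
by move=> e; split; apply: val_inj; rewrite /= -?(vx_div u x) -?(vx_mod u x) e ?vx_div ?vx_mod.
Qed.

Lemma vx_surj i : exists x, i = vx (blk i) x.
Proof.
by exists (inord (i %% b.+1)); apply: val_inj; rewrite /= inordK ?ltn_mod // -divn_eq.
Qed.

(** Turns the enumeration of vertices in an encoding into the order by block and offset in which the
    program writes. *)
Lemma map_blocks (T : Type) (F : nat -> nat -> T) :
  [seq F (i %/ b.+1) (i %% b.+1) | i : 'I_(n * b.+1) <- enum 'I_(n * b.+1)] =
  flatten [seq [seq F u x | x <- iota 0 b.+1] | u <- iota 0 n].
Proof.
transitivity [seq F (i %/ b.+1) (i %% b.+1) | i <- iota 0 (n * b.+1)].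
  by rewrite -val_enum_ord -map_comp.
elim: n => [|n' IHn]; first by rewrite mul0n.
rewrite -[n'.+1 in RHS]addn1 iotaD map_cat flatten_cat -IHn mulSnr iotaD map_cat.
have one (G : nat -> seq T) : flatten [seq G u | u <- iota (0 + n') 1] = G n'.
  by rewrite add0n /= cats0.
rewrite one add0n -{2}[n' * _]addn0 iotaDl -map_comp; congr cat.
apply/eq_in_map => x; rewrite mem_iota add0n => /= lt.
by rewrite /= divnMDl // modnMDl divn_small // modn_small // addn0.
Qed.

End Blocks.

Lemma cmp_past m k :
  ((m.+1 + k < m) = false) * ((m.+1 + k == m) = false) * ((m < m.+1 + k) = true) *
  ((m.+1 + k <= m) = false).
Proof. by repeat split; lia. Qed.

Section Reduction.
Variable F : horn_cnf.
Let n := nvars F.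
Let m := size (clauses F).
Let s := size (enc_horn F).

Definition rows : seq word := [seq bits c.1 | c <- clauses F].
Definition heads : seq nat := [seq nat_of_ord c.2 | c <- clauses F].

(* Block [u] consists, by offset, of the [m] vertices of the clauses with their
   head replaced by [u], the vertex of the variable [u], and [s] vertices that
   carry activity from the clause vertices of the block to the variable. *)
Definition blk_adj (u x u' y : nat) : bool :=
  if x < m then
    if y < m then false else if y == m then nth false (nth [::] rows x) u' else u == u'
  else if x == m then
    if y < m then nth false (nth [::] rows y) u else (m < y) && (u == u')
  else (y <= m) && (u == u').

Definition blk_thr (u x : nat) : nat :=
  if x < m then count id (nth [::] rows x) + (u != nth 0 heads x)
  else if x == m then s else 1.

Definition gadj (i j : 'I_(n * (m + s).+1)) : bool :=
  blk_adj (i %/ (m + s).+1) (i %% (m + s).+1) (j %/ (m + s).+1) (j %% (m + s).+1).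

Lemma gadj_sym : symmetric gadj.
Proof.
move=> i j; rewrite /gadj /blk_adj.
by case: (ltngtP (i %% _) m) => xm; case: (ltngtP (j %% _) m) => ym //=; rewrite eq_sym.
Qed.

Lemma gadj_irr : irreflexive gadj.
Proof. by move=> i; rewrite /gadj /blk_adj; case: ltngtP. Qed.

Definition horn_tss : tss_instance :=
  TSSInstance gadj_sym gadj_irr (fun i => blk_thr (i %/ (m + s).+1) (i %% (m + s).+1)).

Local Notation V := 'I_(nverts horn_tss).
Local Notation vertex := (@vx n (m + s) : 'I_n -> 'I_(m + s).+1 -> V).

Definition block_set (S : {set V}) : {set 'I_n} := (@blk n (m + s)) @: S.

Lemma adj_vertex u x u' y : adj (vertex u x) (vertex u' y) = blk_adj u x u' y.
Proof. by rewrite /= /gadj !vx_div !vx_mod. Qed.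

Lemma thr_vertex u x : thr (vertex u x) = blk_thr u x.
Proof. by rewrite /= vx_div vx_mod. Qed.

(** Each of the [m] clauses contributes a row of [n] bits to the encoding, and the leading unary
    numbers make the inequality strict. Hence all clause vertices together cannot meet the threshold
    [s]. *)
Lemma size_enc_gt : n * m < s.
Proof.
rewrite /s /enc_horn !size_cat /unary !size_rcons !size_nseq.
suff : n * m <= size (flatten [seq bits c.1 ++ rcons (nseq (nat_of_ord c.2) true) false | c <- clauses F]).
  by lia.
rewrite /m; elim: (clauses F) => [|c l IHl] /=; first by rewrite muln0.
by rewrite !size_cat size_bits mulnS -addnA leq_add //; apply: leq_trans IHl (leq_addl _ _).
Qed.

Definition cvx (j : 'I_m) : 'I_(m + s).+1 := inord j.
Definition uvx : 'I_(m + s).+1 := inord m.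
Definition dvx (k : 'I_s) : 'I_(m + s).+1 := inord (m.+1 + k).

Lemma val_cvx j : cvx j = j :> nat.
Proof. by rewrite inordK // ltnS; apply: leq_trans (ltnW (ltn_ord j)) (leq_addr _ _). Qed.

Lemma val_uvx : uvx = m :> nat.
Proof. by rewrite inordK // ltnS leq_addr. Qed.

Lemma val_dvx k : dvx k = m.+1 + k :> nat.
Proof. by rewrite inordK // addSn ltnS ltn_add2l. Qed.

Variant offset_spec : 'I_(m + s).+1 -> Type :=
  | OffsetC j : offset_spec (cvx j)
  | OffsetU : offset_spec uvx
  | OffsetD k : offset_spec (dvx k).

Lemma offsetP x : offset_spec x.
Proof.
case: (ltngtP x m) => xm.
- by rewrite (_ : x = cvx (Ordinal xm)); [constructor | apply: val_inj; rewrite /= val_cvx].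
- have lt : x - m.+1 < s by have := ltn_ord x; lia.
  by rewrite (_ : x = dvx (Ordinal lt)); [constructor | apply: val_inj; rewrite /= val_dvx /=; lia].
- by rewrite (_ : x = uvx); [constructor | apply: val_inj; rewrite /= val_uvx].
Qed.

Definition clause_of (j : 'I_m) : horn_clause n := tnth (in_tuple (clauses F)) j.

Lemma nth_rows j : nth [::] rows (j : 'I_m) = bits (clause_of j).1.
Proof. by rewrite /rows (nth_map (clause_of j)) // {2}/clause_of (tnth_nth (clause_of j)). Qed.

Lemma nth_heads j : nth 0 heads (j : 'I_m) = (clause_of j).2.
Proof. by rewrite /heads (nth_map (clause_of j)) // {2}/clause_of (tnth_nth (clause_of j)). Qed.

Lemma sat_cnfP (a : 'I_n -> bool) :
  reflect (forall j, sat_clause a (clause_of j)) (sat_cnf a).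
Proof. exact: (all_tnthP (t := in_tuple (clauses F))). Qed.

Lemma adj_cc u j u' j' : adj (vertex u (cvx j)) (vertex u' (cvx j')) = false.
Proof. by rewrite adj_vertex /blk_adj !val_cvx !ltn_ord. Qed.

Lemma adj_cu u j u' : adj (vertex u (cvx j)) (vertex u' uvx) = (u' \in (clause_of j).1).
Proof. by rewrite adj_vertex /blk_adj val_cvx val_uvx ltn_ord ltnn eqxx nth_rows nth_bits. Qed.

Lemma adj_cd u j u' k : adj (vertex u (cvx j)) (vertex u' (dvx k)) = (u == u').
Proof.
by rewrite adj_vertex /blk_adj val_cvx val_dvx ltn_ord !cmp_past.
Qed.

Lemma adj_uu u u' : adj (vertex u uvx) (vertex u' uvx) = false.
Proof. by rewrite adj_vertex /blk_adj val_uvx !ltnn eqxx. Qed.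

Lemma adj_ud u u' k : adj (vertex u uvx) (vertex u' (dvx k)) = (u == u').
Proof.
by rewrite adj_vertex /blk_adj val_uvx val_dvx ltnn eqxx !cmp_past.
Qed.

Lemma adj_d u k u' x : adj (vertex u (dvx k)) (vertex u' x) = (x <= m) && (u == u').
Proof.
by rewrite adj_vertex /blk_adj val_dvx !cmp_past.
Qed.

Lemma thr_c u j : thr (vertex u (cvx j)) = #|(clause_of j).1| + (u != (clause_of j).2).
Proof. by rewrite thr_vertex /blk_thr val_cvx ltn_ord nth_rows count_bits nth_heads. Qed.

Lemma thr_u u : thr (vertex u uvx) = s.
Proof. by rewrite thr_vertex /blk_thr val_uvx ltnn eqxx. Qed.

Lemma thr_d u k : thr (vertex u (dvx k)) = 1.
Proof.
by rewrite thr_vertex /blk_thr val_dvx !cmp_past.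
Qed.

Lemma block_set_key (S : {set V}) : is_target_set S -> is_key (block_set S).
Proof.
move=> [r rT] u _ a a_sat; rewrite /sat_clause /=.
apply/orP; case: existsP; [by right | move=> nK; left].
have Ka w : w \in S -> a (blk w).
  move=> wS; apply/negPn/negP => na; apply: nK; exists (blk w).
  by rewrite na andbT; apply/imsetP; exists w.
(* The invariant is that activity never enters the block of a variable false under [a]; in the final
   round it covers the vertex of [u]. *)
suff IH q : forall w, w \in iter q (@activate horn_tss) S -> a (blk w).
  by have := IH r (vertex u uvx); rewrite rT inE blk_vx; apply.
elim: q => [|q IHq] w; first exact: Ka.
rewrite iterS; set X := iter q _ S in IHq *; rewrite !inE => /orP[/IHq // | thr_le].
have [x wE] := vx_surj w; rewrite {}wE in thr_le *; move: (blk w) thr_le => u' {w}.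
rewrite blk_vx; set N := [set _ in X | _] => thr_le; apply/negPn/negP => nau.
have offN y : vertex u' y \in X -> False.
  by move=> /IHq; rewrite blk_vx; apply/negP.
case: (offsetP x) @N thr_le => [j||k] N thr_le.
(* Carriers of the own block are inactive, so only vertices of true body variables count. Meeting
   the threshold forces [u'] to be the head and the whole body to be true, against clause [j]. *)
- have NA : #|N| <= #|[set v in (clause_of j).1 | a v]|.
    rewrite -(card_imset _ (f := fun v => vertex v uvx)); last by move=> v v' /vx_inj[].
    apply/subset_leq_card/subsetP => w; rewrite inE => /andP[wX].
    have [y wE] := vx_surj w; rewrite wE in wX *; move: (blk w) wX => v wX.
    case: (offsetP y) wX => [j'||k] wX.
    + by rewrite [_ (vx _ _)]adj_cc.
    + rewrite [_ (vx _ _)]adj_cu => vj; apply/imsetP; exists v => //.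
      by rewrite inE vj; have := IHq _ wX; rewrite blk_vx.
    + by rewrite [_ (vx _ _)]adj_cd => /eqP e; case: (offN (dvx k)); rewrite e.
  move: thr_le; rewrite [thr _]thr_c => thr_le.
  have sub : [set v in (clause_of j).1 | a v] \subset (clause_of j).1.
    by apply/subsetP => v; rewrite inE => /andP[].
  have uE : u' = (clause_of j).2.
    by apply/eqP; have := subset_leq_card sub; move: thr_le NA; case: eqP => //=; lia.
  have /eqP AE : [set v in (clause_of j).1 | a v] == (clause_of j).1.
    by rewrite eqEcard sub; apply: leq_trans NA; apply: leq_trans thr_le; apply: leq_addr.
  have := sat_cnfP _ a_sat j; rewrite /sat_clause -uE (negbTE nau) /=.
  by case/existsP => v; rewrite -AE inE -andbA; case: (a v); rewrite /= ?andbF.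
(* Apart from the inactive carriers of its block, a variable vertex has only clause vertices as
   neighbors, fewer than [s] in all. *)
- have NC : #|N| <= n * m.
    rewrite -[n]card_ord -[m]card_ord -card_prod.
    rewrite -(card_imset predT (f := fun p => vertex p.1 (cvx p.2))); last first.
      move=> [v j] [v' j'] /vx_inj[/= -> e]; congr pair; apply: val_inj.
      by rewrite /= -(val_cvx j) -(val_cvx j') e.
    apply/subset_leq_card/subsetP => w; rewrite inE => /andP[wX].
    have [y wE] := vx_surj w; rewrite wE in wX *; move: (blk w) wX => v wX.
    case: (offsetP y) wX => [j||k] wX.
    + by move=> _; apply/imsetP; exists (v, j).
    + by rewrite [_ (vx _ _)]adj_uu.
    + by rewrite [_ (vx _ _)]adj_ud => /eqP e; case: (offN (dvx k)); rewrite e.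
  by move: thr_le; rewrite [thr _]thr_u; have := size_enc_gt; lia.
(* A carrier has all its neighbors in its own block, which is inactive. *)
- move: thr_le; rewrite [thr _]thr_d => /card_gt0P[w]; rewrite inE => /andP[wX].
  have [y wE] := vx_surj w; rewrite wE in wX *; move: (blk w) wX => v wX.
  by rewrite [_ (vx _ _)]adj_d => /andP[_ /eqP e]; case: (offN y); rewrite e.
Qed.

Lemma card_block_set (S : {set V}) : #|block_set S| <= #|S|.
Proof. exact: leq_imset_card. Qed.

Definition var_set (K : {set 'I_n}) : {set V} := [set vertex u uvx | u in K].

Lemma card_var_set K : #|var_set K| = #|K|.
Proof. by apply: card_imset => u v /vx_inj[]. Qed.

(** The set of inactive vertices shrinks strictly until a round adds nothing. *)
Lemma activate_fixpoint (G : tss_instance) (S : {set 'I_(nverts G)}) :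
  exists r, activate (iter r (@activate G) S) = iter r (@activate G) S.
Proof.
have [d] := ubnP (#|~: S|); elim: d S => // d IHd S; rewrite ltnS => Sd.
have [fixS | nS] := eqVneq (activate S) S; first by exists 0.
have [|r rE] := IHd (activate S); last by exists r.+1; rewrite iterSr.
apply: leq_trans Sd; apply: proper_card; rewrite properEneq setCS subsetUl andbT.
by apply: contraNneq nS => /setC_inj ->.
Qed.

(** At the fixpoint, the variables with active vertices form a model: an active body activates the
    clause vertex in the block of its head, then the carriers of that block, then the head. A model
    true on a key is true everywhere, and all carriers and clause vertices follow. *)
Lemma var_set_target K : is_key K -> is_target_set (var_set K).
Proof.
move=> Kkey; have [r] := activate_fixpoint (var_set K); set X := iter r _ _ => Xfix.
exists r; apply/setP => w; rewrite inE -/X; apply/idP.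
have SX : var_set K \subset X.
  by rewrite /X; elim: r {X Xfix} => //= r IHr; apply: subset_trans IHr (subsetUl _ _).
have act w' (T : {set V}) : thr w' <= #|T| -> (forall t, t \in T -> (t \in X) && adj w' t) -> w' \in X.
  move=> wT TX; rewrite -Xfix !inE; apply/orP; right; apply: leq_trans wT _.
  by apply/subset_leq_card/subsetP => t /TX; rewrite inE.
have actd u k y : vertex u y \in X -> y <= m -> vertex u (dvx k) \in X.
  move=> uX ym; apply: (act _ [set vertex u y]); first by rewrite thr_d cards1.
  by move=> t /set1P ->; rewrite uX adj_d ym eqxx.
pose a u := vertex u uvx \in X.
have a_sat : sat_cnf a.
  apply/sat_cnfP => j; rewrite /sat_clause; apply/orP.
  case: existsP => [|nA]; [by right | left].
  have aA v : v \in (clause_of j).1 -> a v.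
    by move=> vA; apply/negPn/negP => nav; apply: nA; exists v; rewrite vA.
  set u := (clause_of j).2.
  have cX : vertex u (cvx j) \in X.
    apply: (act _ [set vertex v uvx | v in (clause_of j).1]).
      by rewrite thr_c eqxx addn0 card_imset // => v v' /vx_inj[].
    by move=> t /imsetP[v vA ->]; rewrite adj_cu vA andbT; apply: aA.
  have dX k : vertex u (dvx k) \in X.
    by apply: actd cX _; rewrite val_cvx ltnW.
  apply: (act _ [set vertex u (dvx k) | k in 'I_s]).
    rewrite thr_u card_imset ?card_ord // => k k' /vx_inj[_ /(congr1 val)] /=.
    by rewrite !val_dvx => /addnI/val_inj.
  by move=> t /imsetP[k _ ->]; rewrite dX adj_ud eqxx.
have aT u : a u.
  have [uK | uK] := boolP (u \in K); first by apply: (subsetP SX); apply/imsetP; exists u.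
  have := Kkey u uK a a_sat; rewrite /sat_clause /= => /orP[] // /existsP[v /andP[vK]].
  by rewrite (_ : a v) //; apply: (subsetP SX); apply/imsetP; exists v.
have [x ->] := vx_surj w; move: (blk w) => u.
case: (offsetP x) => [j||k]; [|exact: aT|by apply: actd (aT u) _; rewrite val_uvx].
have s_gt0 : 0 < s by apply: leq_ltn_trans size_enc_gt.
pose d := vertex u (dvx (Ordinal s_gt0)).
have dX : d \in X by apply: actd (aT u) _; rewrite val_uvx.
(* The carrier [d] supplies the extra unit of the threshold that arises when [u] is not the head of
   clause [j]. *)
apply: (act _ (d |: [set vertex v uvx | v in (clause_of j).1])).
  rewrite thr_c cardsU1 card_imset; last by move=> v v' /vx_inj[].
  rewrite addnC leq_add2r (_ : d \notin _) ?leq_b1 //.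
  by apply/imsetP => -[v _ /vx_inj[_ /(congr1 val)]] /=; rewrite val_dvx val_uvx; lia.
move=> t /setU1P[-> | /imsetP[v vA ->]]; first by rewrite dX adj_cd eqxx.
by rewrite adj_cu vA andbT; apply: aT.
Qed.

End Reduction.

(** * Programs for the two conversions *)

Arguments den : simpl never.

Lemma den_push i b s : den (Push i b) s = set_nth [::] s i (b :: reg s i).
Proof. by []. Qed.

Lemma den_pop i s : den (Pop i) s = set_nth [::] s i (behead (reg s i)).
Proof. by []. Qed.

Lemma den_seq p q s : den (Seq p q) s = den q (den p s).
Proof. by []. Qed.

Lemma den_for i p x s :
  den (For i p) (x :: s) = foldl (fun s b => den (p b) s) (x :: s) (reg (x :: s) i).
Proof. by []. Qed.

Lemma den_skip s : den Skip s = s.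
Proof. by []. Qed.

(* Restricting these rules to explicit states keeps them from firing on the
   result of a loop that is not yet evaluated. *)
Lemma den_push_cons i b x s :
  den (Push i b) (x :: s) = set_nth [::] (x :: s) i (b :: reg (x :: s) i).
Proof. by []. Qed.

Lemma den_pop_cons i x s :
  den (Pop i) (x :: s) = set_nth [::] (x :: s) i (behead (reg (x :: s) i)).
Proof. by []. Qed.

Lemma den_case_cons i p x s :
  den (Case i p) (x :: s) = den (p (ohead (reg (x :: s) i))) (x :: s).
Proof. by []. Qed.

Definition denE := (den_seq, den_push_cons, den_pop_cons, den_case_cons, den_skip).

Ltac run := do ?[rewrite !denE /=].

Lemma foldl_push (f : bool -> bool) j s w : j < size s ->
  foldl (fun s b => den (Push j (f b)) s) s w = set_nth [::] s j (rev (map f w) ++ reg s j).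
Proof.
elim: w s => [|b w IHw] s js /=; first by apply: (@eq_from_nth _ [::]);
  rewrite ?size_set_nth ?(maxn_idPr _) // => i _; rewrite nth_set_nth /=; case: eqP => [->|].
rewrite IHw ?size_set_nth ?leq_max ?js ?orbT // den_push /reg nth_set_nth /= eqxx.
by rewrite set_set_nth eqxx rev_cons cat_rcons.
Qed.

Lemma den_copy i j x s : j < size (x :: s) ->
  den (For i (Push j)) (x :: s) = set_nth [::] (x :: s) j (rev (reg (x :: s) i) ++ reg (x :: s) j).
Proof. by move=> js; rewrite den_for (foldl_push id) // map_id. Qed.

Lemma den_fill i j c x s : j < size (x :: s) ->
  den (For i (fun=> Push j c)) (x :: s) = set_nth [::] (x :: s) j (nseq (size (reg (x :: s) i)) c ++ reg (x :: s) j).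
Proof.
move=> js; rewrite den_for (foldl_push (fun=> c)) //; move: (reg _ i) => w.
have -> : map (fun=> c) w = nseq (size w) c by elim: w => //= ? ? ->.
by rewrite rev_nseq.
Qed.

Lemma den_drop i j x s : j < size (x :: s) ->
  den (For i (fun=> Pop j)) (x :: s) = set_nth [::] (x :: s) j (drop (size (reg (x :: s) i)) (reg (x :: s) j)).
Proof.
rewrite den_for; move: (reg _ i) => w; move: (x :: s) => {x}{}s; elim: w s => [|b w IHw] s js /=.
  rewrite drop0; apply: (@eq_from_nth _ [::]); rewrite ?size_set_nth ?(maxn_idPr _) // => l _.
  by rewrite nth_set_nth /=; case: eqP => [->|].
rewrite IHw ?size_set_nth ?leq_max ?js ?orbT // den_pop /reg nth_set_nth /= eqxx.
by rewrite set_set_nth eqxx -drop1 drop_drop addn1.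
Qed.

Local Notation rInp := 0.
Local Notation rSol := 1.
Local Notation rMode := 2.
Local Notation rSize := 3.
Local Notation rN := 4.
Local Notation rM := 5.
Local Notation rRest := 6.

(* [rMode] is empty while the number of variables is read, then its top is
   [false] while the number of clauses is read, and [true] afterwards. *)
Definition parse : cmd :=
  For rInp (fun b => Seq (Push rSize true) (Case rMode (fun o => match o with
    | None => if b then Push rN true else Push rMode false
    | Some false => if b then Push rM true else Push rMode true
    | Some true => Push rRest b
    end))).

Lemma nseq_rcons T (x : T) k w : nseq k x ++ x :: w = nseq k.+1 x ++ w.
Proof. by elim: k => //= k ->. Qed.

Lemma den_parse n m w sol rest :
  let inp := unary n ++ unary m ++ w in
  den parse [:: inp, sol, [::], [::], [::], [::], [::] & rest] =
  [:: inp, sol, [:: true; false], nseq (size inp) true, nseq n true, nseq m true, rev w & rest].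
Proof.
move=> inp; rewrite den_for [reg _ _]/= {2}/inp /unary !cat_rcons !foldl_cat /=.
have -> : nseq (size inp) true = nseq (size w + m.+1 + n.+1) true.
  by congr nseq; rewrite /inp /unary !size_cat !size_rcons !size_nseq; lia.
move: inp => inp.
set body := fun s b => _.
have readn k a c : foldl body [:: inp, sol, [::], a, c, [::], [::] & rest] (nseq k true) =
    [:: inp, sol, [::], nseq k true ++ a, nseq k true ++ c, [::], [::] & rest].
  by elim: k a c => //= k IHk a c; run; rewrite IHk !nseq_rcons.
have readm k a c d : foldl body [:: inp, sol, [:: false], a, c, d, [::] & rest] (nseq k true) =
    [:: inp, sol, [:: false], nseq k true ++ a, c, nseq k true ++ d, [::] & rest].
  by elim: k a d => //= k IHk a d; run; rewrite IHk !nseq_rcons.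
have readw v a c d t : foldl body [:: inp, sol, [:: true; false], a, c, d, t & rest] v =
    [:: inp, sol, [:: true; false], nseq (size v) true ++ a, c, d, rev v ++ t & rest].
  elim: v a t => //= b v IHv a t; run; rewrite IHv.
  by rewrite nseq_rcons rev_cons cat_rcons.
rewrite readn; run; rewrite foldl_cat readm /=; run; rewrite readw !cats0.
congr [:: _, _, _, _, _, _, _ & _].
by rewrite -[_ :: _]/(nseq m.+1 true ++ nseq n.+1 true) -!nseqD addnA.
Qed.

(** * The program that writes the graph *)

Local Notation rM2 := 7.
Local Notation rY := 8.
Local Notation rZ := 9.
Local Notation rE := 10.
Local Notation rC := 11.
Local Notation rF := 12.
(* [rCol'] receives a column of the incidence matrix in reverse order. *)
Local Notation rCol' := 13.
Local Notation rCol := 14.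
Local Notation rAdj := 15.
Local Notation rThr := 16.
Local Notation rOut := 17.

(** Reads the indicator word of the block in [rE] against a clause body on [rC] and writes the
    adjacency row of the clause vertex, one block per round. A body bit raises the threshold; two
    set bits mean that the variable of the block is in the body, which is recorded on [rCol']. The
    copy [rM2] is used because an enclosing loop runs over [rM]. *)
Definition scan_body (b : bool) : cmd :=
  Case rC (fun o => if o is Some a then
    Seq (Pop rC) (Seq (For rM2 (fun=> Push rAdj false)) (Seq (Push rAdj a)
    (Seq (For rSize (fun=> Push rAdj b))
    (if a then Seq (Push rThr true) (if b then Seq (Pop rCol') (Push rCol' true) else Skip)
     else Skip))))
  else Skip).

(** The unary head is popped in step with [rE], so its closing [false] meets the letter of [rE] at
    the position of the head. Unless that letter is set, the threshold gets its extra unit. [rF]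
    makes later rounds idle. *)
Definition head_body (b : bool) : cmd :=
  Case rF (fun f => if f is Some _ then Skip else
    Case rC (fun o => if o is Some true then Pop rC else
      Seq (Pop rC) (Seq (Push rF true) (if b then Skip else Push rThr true)))).

Definition clause_body : cmd :=
  Seq (Push rCol' false) (Seq (For rE scan_body) (Seq (For rE head_body)
  (Seq (Pop rF) (Push rThr false)))).

(** [rZ] and [rY] count the blocks before and after the current one, which yields its indicator word
    in [rE]. In the loop over [rSize], [rInp] serves as a second word of length [s], since the body
    may not touch [rSize]. *)
Definition block_body : cmd :=
  Seq (Pop rY) (Seq (For rY (fun=> Push rE false)) (Seq (Push rE true)
  (Seq (For rZ (fun=> Push rE false))
  (Seq (For rRest (Push rC)) (Seq (For rM (fun=> clause_body))
  (Seq (For rCol' (Push rCol))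
  (Seq (For rE (fun b => Seq (For rCol (Push rAdj))
                        (Seq (Push rAdj false) (For rSize (fun=> Push rAdj b)))))
  (Seq (For rSize (fun=> Push rThr true)) (Seq (Push rThr false)
  (Seq (For rSize (fun=>
     Seq (For rE (fun b => Seq (For rM (fun=> Push rAdj b))
                          (Seq (Push rAdj b) (For rInp (fun=> Push rAdj false)))))
     (Seq (Push rThr true) (Push rThr false))))
  (Seq (For rM (fun=> Pop rCol')) (Seq (For rM (fun=> Pop rCol))
  (Seq (For rY (fun=> Pop rE)) (Seq (Pop rE) (Seq (For rZ (fun=> Pop rE))
  (Push rZ false)))))))))))))))).

(** Pushing builds a word from its end, so the output is assembled backwards: thresholds, adjacency
    rows, and last the unary number of vertices, one block size per variable. *)
Definition horn_tss_prog : cmd :=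
  Seq parse (Seq (For rM (fun=> Push rM2 true)) (Seq (For rN (fun=> Push rY false))
  (Seq (For rN (fun=> block_body))
  (Seq (For rThr (Push rOut)) (Seq (For rAdj (Push rOut)) (Seq (Push rOut false)
  (For rN (fun=> Seq (For rM (fun=> Push rOut true)) (Seq (Push rOut true)
    (For rSize (fun=> Push rOut true))))))))))).

Lemma wf_horn_tss_prog : wf 18 horn_tss_prog.
Proof. by []. Qed.

Section HornTss.
Variables (n m s : nat) (inp mode rest : word).
Hypothesis inp_size : size inp = s.

Local Notation st := (fun y z e c f col' col adj thr =>
  [:: inp; [::]; mode; nseq s true; nseq n true; nseq m true; rest; nseq m true;
      y; z; e; c; f; col'; col; adj; thr; [::]]).

(** [crow], [urow] and [drow] are the adjacency rows of a clause vertex with body [A], of a variable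
    vertex with clause incidences [col], and of a carrier, in the block with indicator word [E]. *)
Definition crow (A E : word) : word :=
  flatten [seq nseq m false ++ p.1 :: nseq s p.2 | p <- zip A E].
Definition urow (col E : word) : word := flatten [seq col ++ false :: nseq s b | b <- E].
Definition drow (E : word) : word := flatten [seq nseq m b ++ b :: nseq s false | b <- E].

Definition hit (E A : word) : bool := has (fun p => p.1 && p.2) (zip A E).

Lemma den_scan y z e c f h col' col adj thr A E : size A = size E ->
  foldl (fun s b => den (scan_body b) s) (st y z e (A ++ c) f (h :: col') col adj thr) E =
  st y z e c f ((h || hit E A) :: col') col (rev (crow A E) ++ adj)
     (nseq (count id A) true ++ thr).
Proof.
elim: E A h adj thr => [|b E IHE] [|a A] h adj thr //= => [_|[eqA]]; first by rewrite orbF.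
rewrite {2}/scan_body; run; rewrite !den_fill //= !size_nseq.
rewrite /hit /crow /= -/(hit E A) -/(crow A E) !rev_cat rev_cons !rev_nseq cat_rcons.
case: a; run; last by rewrite IHE // -!catA.
by case: b; run; rewrite IHE // ?orbT -!catA (nseq_rcons true (count id A)).
Qed.

Lemma den_head y z e c col' col adj thr v E : v < size E ->
  foldl (fun s b => den (head_body b) s) (st y z e (unary v ++ c) [::] col' col adj thr) E =
  st y z e c [:: true] col' col adj (nseq (~~ nth false E v) true ++ thr).
Proof.
have done E' thr' : foldl (fun s b => den (head_body b) s)
    (st y z e c [:: true] col' col adj thr') E' = st y z e c [:: true] col' col adj thr'.
  by elim: E' => //= b E' IHE; rewrite {2}/head_body; run.
elim: E v => [|b E IHE] [|v] //= vE; rewrite {2}/head_body; run; last exact: IHE.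
by case: b; run; rewrite done.
Qed.

Definition enc_clauses (L : seq (word * nat)) : word :=
  flatten [seq cl.1 ++ unary cl.2 | cl <- L].

Lemma enc_clauses_cons A v L : enc_clauses ((A, v) :: L) = A ++ unary v ++ enc_clauses L.
Proof. by rewrite /enc_clauses /= -catA. Qed.

Definition cthr (E : word) (cl : word * nat) : nat := count id cl.1 + ~~ nth false E cl.2.

Arguments enc_clauses : simpl never.

Lemma den_clauses y z E c col' col adj thr L :
    all (fun cl => (size cl.1 == size E) && (cl.2 < size E)) L ->
  foldl (fun s _ => den clause_body s)
    (st y z E (enc_clauses L ++ c) [::] col' col adj thr) (nseq (size L) true) =
  st y z E c [::] (rev [seq hit E cl.1 | cl <- L] ++ col') col
     (rev (flatten [seq crow cl.1 E | cl <- L]) ++ adj)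
     (rev (flatten [seq unary (cthr E cl) | cl <- L]) ++ thr).
Proof.
elim: L col' adj thr => [|[A v] L IHL] col' adj thr //=.
rewrite enc_clauses_cons -catA => /andP[/andP[/eqP sA vE] LE].
rewrite {2}/clause_body; run; rewrite den_for /= -catA den_scan //.
rewrite den_for /= den_head //; run; rewrite IHL //.
rewrite !rev_cat rev_cons cat_rcons -!catA /unary rev_rcons rev_nseq /cthr addnC nseqD.
by rewrite /= -catA.
Qed.

Lemma den_urow y z e c f col' col adj thr E :
  foldl (fun s b => den (Seq (For rCol (Push rAdj))
      (Seq (Push rAdj false) (For rSize (fun=> Push rAdj b)))) s)
    (st y z e c f col' col adj thr) E =
  st y z e c f col' col (rev (urow col E) ++ adj) thr.
Proof.
elim: E adj => [|b E IHE] adj //=; run; rewrite den_copy //=; run.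
rewrite den_fill //= size_nseq IHE /urow /= !rev_cat rev_cons rev_nseq.
by rewrite -!catA cat_rcons.
Qed.

Lemma den_drow y z e c f col' col adj thr E :
  foldl (fun s b => den (Seq (For rM (fun=> Push rAdj b))
      (Seq (Push rAdj b) (For rInp (fun=> Push rAdj false)))) s)
    (st y z e c f col' col adj thr) E =
  st y z e c f col' col (rev (drow E) ++ adj) thr.
Proof.
elim: E adj => [|b E IHE] adj //=; run; rewrite den_fill //=; run.
rewrite den_fill //= size_nseq inp_size IHE /drow /= !rev_cat rev_cons !rev_nseq.
by rewrite -!catA cat_rcons.
Qed.

Definition badj (L : seq (word * nat)) (E : word) : word :=
  flatten [seq crow cl.1 E | cl <- L] ++ urow [seq hit E cl.1 | cl <- L] E ++
  flatten (nseq s (drow E)).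

Definition bthr (L : seq (word * nat)) (E : word) : word :=
  flatten [seq unary (cthr E cl) | cl <- L] ++ unary s ++ flatten (nseq s (unary 1)).

Definition unit_word (u : nat) : word := nseq u false ++ true :: nseq (n - u.+1) false.

Lemma size_unit_word u : u < n -> size (unit_word u) = n.
Proof. by move=> un; rewrite size_cat /= !size_nseq; lia. Qed.

Lemma den_block u k adj thr L : u + k.+1 = n -> size L = m -> rest = rev (enc_clauses L) ->
    all (fun cl => (size cl.1 == n) && (cl.2 < n)) L ->
  den block_body
    (st (nseq k.+1 false) (nseq u false) [::] [::] [::] [::] [::] adj thr) =
  st (nseq k false) (nseq u.+1 false) [::] [::] [::] [::] [::]
    (rev (badj L (unit_word u)) ++ adj) (rev (bthr L (unit_word u)) ++ thr).
Proof.
move=> uk Lm restE Ln; rewrite /block_body; run.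
rewrite den_fill //= size_nseq cats0; run; rewrite den_fill //= size_nseq.
have -> : nseq u false ++ true :: nseq k false = unit_word u.
  by rewrite /unit_word (_ : n - u.+1 = k) //; lia.
have un : u < n by lia.
have sE := size_unit_word un; set E := unit_word u in sE *.
rewrite den_copy //= {2}restE revK.
have clausesE := @den_clauses (nseq k false) (nseq u false) E [::] [::] [::] adj thr L.
rewrite den_for /=; rewrite Lm sE in clausesE; rewrite {}clausesE //.
rewrite den_copy //= !cats0 revK den_for /= den_urow.
rewrite den_fill //= size_nseq; run.
set drows := Seq (For rE _) _.
have drowsE q adj' thr' : foldl (fun s _ => den drows s)
    (st (nseq k false) (nseq u false) E [::] [::] (rev [seq hit E cl.1 | cl <- L])
       [seq hit E cl.1 | cl <- L] adj' thr') (nseq q true) =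
    st (nseq k false) (nseq u false) E [::] [::] (rev [seq hit E cl.1 | cl <- L])
       [seq hit E cl.1 | cl <- L] (rev (flatten (nseq q (drow E))) ++ adj')
       (rev (flatten (nseq q (unary 1))) ++ thr').
  elim: q adj' thr' => //= q IHq adj' thr'; rewrite {2}/drows; run.
  rewrite den_for /= den_drow; run; rewrite IHq.
  by rewrite !rev_cat -!catA !rev_cons -!cats1 -!catA.
rewrite den_for /= drowsE.
(* The closing pops match the lengths [m] and [n] of the work words, so these registers are empty
   again for the next block. *)
do 2 (rewrite den_drop //=; run). do 2 (rewrite den_drop //=; run).
rewrite !size_nseq -drop1 !drop_drop.
rewrite drop_oversize ?drop_oversize ?size_rev ?size_map ?Lm ?sE //; last by lia.
by rewrite /badj /bthr !rev_cat [rev (unary s)]rev_rcons rev_nseq -!catA.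
Qed.

Lemma den_blocks u k adj thr L : u + k = n -> size L = m -> rest = rev (enc_clauses L) ->
    all (fun cl => (size cl.1 == n) && (cl.2 < n)) L ->
  foldl (fun s _ => den block_body s)
    (st (nseq k false) (nseq u false) [::] [::] [::] [::] [::] adj thr) (nseq k true) =
  st [::] (nseq n false) [::] [::] [::] [::] [::]
    (rev (flatten [seq badj L (unit_word u) | u <- iota u k]) ++ adj)
    (rev (flatten [seq bthr L (unit_word u) | u <- iota u k]) ++ thr).
Proof.
move=> uk Lm restE Ln; elim: k u uk adj thr => [|k IHk] u uk adj thr.
  by rewrite addn0 in uk; rewrite /= uk.
rewrite [nseq k.+1 true]/= [foldl _ _ (_ :: _)]/= (den_block _ _ uk Lm restE Ln) IHk ?addSnnS //.
by rewrite /= !rev_cat -!catA.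
Qed.

End HornTss.

Lemma den_horn_tss_prog n m L : size L = m ->
    all (fun cl => (size cl.1 == n) && (cl.2 < n)) L ->
  let inp := unary n ++ unary m ++ enc_clauses L in
  let s := size inp in
  reg (den horn_tss_prog (inp :: nseq 17 [::])) rOut =
  unary (n * (m + s).+1) ++
  flatten [seq badj m s L (unit_word n u) | u <- iota 0 n] ++
  flatten [seq bthr s L (unit_word n u) | u <- iota 0 n].
Proof.
move=> Lm Ln inp s; rewrite /horn_tss_prog; run.
rewrite den_parse -/inp -/s den_fill //= size_nseq !cats0; run.
rewrite den_fill //= size_nseq cats0; run.
rewrite den_for /=.
have := @den_blocks n m s inp [:: true; false] (rev (enc_clauses L)) (erefl s) 0 n [::] [::] L
  (erefl n) Lm (erefl _) Ln.
move=> /= ->.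
rewrite !cats0 den_copy //= cats0 revK den_copy //= revK; run.
rewrite den_for /=.
set tl := _ ++ _.
set fin := Seq _ _.
move: (rev (flatten [seq badj _ _ _ _ | u <- _])) => adj.
move: (rev (flatten [seq bthr _ _ _ | u <- _])) => thr.
have finE q o : foldl (fun s _ => den fin s)
    [:: inp; [::]; [:: true; false]; nseq s true; nseq n true; nseq m true;
        rev (enc_clauses L); nseq m true; [::]; nseq n false; [::]; [::]; [::]; [::]; [::];
        adj; thr; o] (nseq q true) =
    [:: inp; [::]; [:: true; false]; nseq s true; nseq n true; nseq m true;
        rev (enc_clauses L); nseq m true; [::]; nseq n false; [::]; [::]; [::]; [::]; [::];
        adj; thr; nseq (q * (m + s).+1) true ++ o].
  elim: q o => // q IHq o.
  have -> : nseq (q.+1 * (m + s).+1) true ++ o =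
      nseq (q * (m + s).+1) true ++ nseq s true ++ true :: nseq m true ++ o.
    have -> : (m + s).+1 = s + m.+1 by rewrite addnS addnC.
    by rewrite mulSnr !nseqD -!catA.
  rewrite [nseq q.+1 _]/= [LHS]/= {2}/fin; run.
  by rewrite den_fill //= size_nseq; run; rewrite den_fill //= size_nseq IHq.
by rewrite finE /= /unary cat_rcons.
Qed.

(** * The program that recovers a key from a target set *)

Local Notation rBlock := 7.
Local Notation rKey := 8.
Local Notation rBits := 9.

Definition or_body : cmd :=
  Case rSol (fun o => Seq (Pop rSol)
    (if o is Some true then Seq (Pop rKey) (Push rKey true) else Skip)).

(** [rBlock] has the length of a block. Each round over [rN] puts a fresh bit on [rKey], which
    accumulates the disjunction of one block of solution bits. *)
Definition block_set_prog : cmd :=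
  Seq parse (Seq (For rM (fun=> Push rBlock true)) (Seq (Push rBlock true)
  (Seq (For rSize (fun=> Push rBlock true))
  (Seq (For rN (fun=> Seq (Push rKey false) (For rBlock (fun=> or_body))))
  (For rKey (Push rBits)))))).

Lemma wf_block_set_prog : wf 10 block_set_prog.
Proof. by []. Qed.

Lemma den_block_set_prog n m w (bss : seq word) :
  let inp := unary n ++ unary m ++ w in
  size bss = n -> all (fun bs => size bs == (m + size inp).+1) bss ->
  reg (den block_set_prog (inp :: flatten bss :: nseq 8 [::])) rBits =
  [seq has id bs | bs <- bss].
Proof.
move=> inp bssn; set B := (m + size inp).+1 => bssB; rewrite /block_set_prog; run.
rewrite den_parse -/inp !den_fill //= !size_nseq !cats0; run.
have -> : nseq (size inp) true ++ true :: nseq m true = nseq B true.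
  by rewrite nseq_rcons -nseqD addSn addnC.
rewrite den_for /=.
set body := Seq _ _.
set mode := [:: true; false]; set ns := nseq (size inp) true; set nm := nseq m true.
set nn := nseq n true; move: (rev w) => rest.
have scan bs sol h key : foldl (fun s _ => den or_body s)
    [:: inp; bs ++ sol; mode; ns; nn; nm; rest; nseq B true; h :: key; [::]] (nseq (size bs) true) =
    [:: inp; sol; mode; ns; nn; nm; rest; nseq B true; (h || has id bs) :: key; [::]].
  elim: bs h => [|b bs IHbs] h /=; first by rewrite orbF.
  by rewrite {2}/or_body; run; case: b; run; rewrite IHbs ?orbT.
have loop key : foldl (fun s _ => den body s)
    [:: inp; flatten bss; mode; ns; nn; nm; rest; nseq B true; key; [::]] nn =
    [:: inp; [::]; mode; ns; nn; nm; rest; nseq B true;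
        rev [seq has id bs | bs <- bss] ++ key; [::]].
  rewrite {2}/nn -bssn; elim: bss bssB key {bssn} => //= bs bss IHbss /andP[/eqP bsB bssB] key.
  rewrite {2}/body; have scanE := scan bs (flatten bss) false key; rewrite bsB in scanE.
  by run; rewrite den_for [reg _ _]/= scanE IHbss // rev_cons cat_rcons.
by rewrite loop cats0 den_copy //= revK cats0.
Qed.

(** * Agreement of the program outputs with the encodings *)

Lemma map_iota_split (T : Type) (f : nat -> T) m s :
  [seq f y | y <- iota 0 (m + s).+1] =
  [seq f y | y <- iota 0 m] ++ f m :: [seq f y | y <- iota m.+1 s].
Proof. by rewrite -addnS iotaD map_cat. Qed.

Lemma flatten_cons (T : Type) (s : seq T) ss : flatten (s :: ss) = s ++ flatten ss.
Proof. by []. Qed.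

Lemma map_iota_const (T : Type) (f : nat -> T) a k c :
  (forall y, a <= y < a + k -> f y = c) -> [seq f y | y <- iota a k] = nseq k c.
Proof.
move=> fc; rewrite -[k in RHS](size_iota a); move: fc.
have : forall y, y \in iota a k -> a <= y < a + k by move=> y; rewrite mem_iota.
elim: (iota a k) => //= y l IHl yl fc; rewrite fc ?yl ?inE ?eqxx // IHl // => z zl.
by apply: yl; rewrite inE zl orbT.
Qed.

Lemma unit_wordE n u : u < n -> unit_word n u = [seq u == u' | u' <- iota 0 n].
Proof.
move=> un; rewrite {2}(_ : n = u + (n - u.+1).+1); last by lia.
rewrite iotaD map_cat add0n /= eqxx /unit_word; congr (_ ++ _ :: _).
  by rewrite (@map_iota_const _ _ _ _ false) // => y yu; apply/negbTE; lia.
by rewrite (@map_iota_const _ _ _ _ false) // => y yu; apply/negbTE; lia.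
Qed.

Lemma word_iota (A : word) n : size A = n -> A = [seq nth false A u | u <- iota 0 n].
Proof. by move=> <-; rewrite -[LHS](mkseq_nth false). Qed.

Lemma zip_unit_word (A : word) n u : size A = n -> u < n ->
  zip A (unit_word n u) = [seq (nth false A u', u == u') | u' <- iota 0 n].
Proof.
move=> sA un; rewrite unit_wordE // {1}(word_iota sA) zip_map //.
Qed.

Lemma hit_unit_word (A : word) n u : size A = n -> u < n -> hit (unit_word n u) A = nth false A u.
Proof.
move=> sA un; rewrite /hit zip_unit_word // has_map.
apply/hasP/idP => [[u' _ /= /andP[Au /eqP -> //]] | Au].
by exists u; rewrite ?mem_iota //= Au eqxx.
Qed.

Lemma flatten2 (T : Type) (ss : seq (seq (seq T))) :
  flatten (flatten ss) = flatten [seq flatten s | s <- ss].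
Proof. by elim: ss => //= s ss IHss; rewrite flatten_cat IHss. Qed.

Section Encoding.
Variable F : horn_cnf.
Let n := nvars F.
Let m := size (clauses F).
Let s := size (enc_horn F).
Let L : seq (word * nat) := [seq (bits c.1, nat_of_ord c.2) | c <- clauses F].

Lemma enc_hornE : enc_horn F = unary n ++ unary m ++ enc_clauses L.
Proof. by rewrite /enc_horn /enc_clauses -map_comp. Qed.

Lemma clauses_wf : all (fun cl => (size cl.1 == n) && (cl.2 < n)) L.
Proof. by rewrite all_map; apply/allP => c _ /=; rewrite size_bits eqxx ltn_ord. Qed.

(** Supplies the default element for [nth_map]; [horn_clause n] is empty when [n] is 0, so an index
    below [m] has to provide one. *)
Lemma clause0 x : x < m -> horn_clause n.
Proof. by rewrite /m; case: (clauses F). Qed.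

Lemma map_rows (T : Type) (f : word -> nat -> T) :
  [seq f cl.1 cl.2 | cl <- L] =
  [seq f (nth [::] (rows F) x) (nth 0 (heads F) x) | x <- iota 0 m].
Proof.
rewrite -map_comp -[LHS](mkseq_nth (f [::] 0)) size_map /mkseq -/m.
apply/eq_in_map => x; rewrite mem_iota /= => xm.
have c0 := clause0 xm.
by rewrite (nth_map c0) //= /rows /heads !(nth_map c0).
Qed.

Lemma size_row x : x < m -> size (nth [::] (rows F) x) = n.
Proof.
move=> xm; have c0 := clause0 xm.
by rewrite /rows (nth_map c0) // size_bits.
Qed.

Lemma head_lt x : x < m -> nth 0 (heads F) x < n.
Proof.
move=> xm; have c0 := clause0 xm.
by rewrite /heads (nth_map c0).
Qed.

Lemma adj_block u : u < n ->
  flatten [seq flatten [seq [seq blk_adj F u x u' y | y <- iota 0 (m + s).+1] | u' <- iota 0 n]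
          | x <- iota 0 (m + s).+1] = badj m s L (unit_word n u).
Proof.
move=> un; rewrite [X in flatten X = _]map_iota_split flatten_cat flatten_cons /badj.
congr cat; [|congr cat].
- rewrite (map_rows (fun A _ => crow m s A (unit_word n u))); congr flatten.
  apply/eq_in_map => x; rewrite mem_iota add0n => /andP[_ xm].
  rewrite /crow (zip_unit_word (size_row xm) un) -map_comp; congr flatten.
  apply/eq_in_map => u' _; rewrite [RHS]/=; cbv beta; rewrite map_iota_split; congr (_ ++ _ :: _).
  + by apply: map_iota_const => y ym; rewrite /blk_adj xm; case: ltnP => //; lia.
  + by rewrite /blk_adj xm ltnn eqxx.
  + apply: map_iota_const => y ym; rewrite /blk_adj xm.
    by case: ltngtP => //; lia.
- rewrite /urow {2}(unit_wordE un) -map_comp; congr flatten.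
  apply/eq_in_map => u' _; rewrite [RHS]/=; cbv beta; rewrite map_iota_split; congr (_ ++ _ :: _).
  + rewrite (map_rows (fun A _ => hit (unit_word n u) A)).
    apply/eq_in_map => y; rewrite mem_iota add0n => /andP[_ ym].
    by rewrite (hit_unit_word (size_row ym) un) /blk_adj ltnn eqxx ym.
  + by rewrite /blk_adj !ltnn eqxx.
  + apply: map_iota_const => y ym; rewrite /blk_adj ltnn eqxx.
    by case: ltngtP => //; lia.
- congr flatten; apply: map_iota_const => x xm.
  rewrite /drow (unit_wordE un) -map_comp; congr flatten.
  have e : (x < m = false) * ((x == m) = false) by split; apply/negbTE; lia.
  apply/eq_in_map => u' _; rewrite [RHS]/=; cbv beta; rewrite map_iota_split; congr (_ ++ _ :: _).
  + by apply: map_iota_const => y ym; rewrite /blk_adj !e (_ : y <= m) //; lia.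
  + by rewrite /blk_adj !e leqnn.
  + by apply: map_iota_const => y ym; rewrite /blk_adj !e (_ : y <= m = false) //; apply/negbTE; lia.
Qed.

Lemma thr_block u : u < n ->
  flatten [seq unary (blk_thr F u x) | x <- iota 0 (m + s).+1] = bthr s L (unit_word n u).
Proof.
move=> un; rewrite map_iota_split flatten_cat flatten_cons /bthr.
congr cat; [|congr cat].
- rewrite (map_rows (fun A v => unary (cthr (unit_word n u) (A, v)))); congr flatten.
  apply/eq_in_map => x; rewrite mem_iota add0n => /andP[_ xm]; congr unary.
  rewrite /blk_thr xm /cthr /= unit_wordE // (nth_map 0) ?size_iota ?head_lt //.
  by rewrite nth_iota ?head_lt.
- by rewrite /blk_thr ltnn eqxx.
- congr flatten; apply: map_iota_const => x xm; congr unary.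
  by rewrite /blk_thr; case: ltngtP => //; lia.
Qed.

Lemma enc_horn_tss : enc_tss (horn_tss F) =
  unary (n * (m + s).+1) ++
  flatten [seq badj m s L (unit_word n u) | u <- iota 0 n] ++
  flatten [seq bthr s L (unit_word n u) | u <- iota 0 n].
Proof.
rewrite /enc_tss /= -/n -/m -/s; congr (_ ++ (_ ++ _)).
- rewrite /gadj -/n -/m -/s.
  under eq_map => i do rewrite (map_blocks n (m + s) (blk_adj F (i %/ (m + s).+1) (i %% (m + s).+1))).
  rewrite (map_blocks n (m + s) (fun u x => flatten [seq [seq blk_adj F u x u' y
     | y <- iota 0 (m + s).+1] | u' <- iota 0 n])) flatten2 -map_comp; congr flatten.
  by apply/eq_in_map => u; rewrite mem_iota /= => un; apply: adj_block.
- rewrite (map_blocks n (m + s) (fun u x => unary (blk_thr F u x))) flatten2 -map_comp; congr flatten.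
  by apply/eq_in_map => u; rewrite mem_iota /= => un; apply: thr_block.
Qed.

(** Vertices are numbered block by block, so the bits of [S] split into [n] consecutive words, and a
    block meets [S] exactly when its word has a set bit. *)
Lemma bits_block_set (S : {set 'I_(nverts (horn_tss F))}) :
  exists bss : seq word, [/\ bits S = flatten bss, size bss = n,
    all (fun bs => size bs == (m + s).+1) bss &
    bits (block_set S) = [seq has id bs | bs <- bss]].
Proof.
pose f u x := nth false (bits S) (u * (m + s).+1 + x).
exists [seq [seq f u x | x <- iota 0 (m + s).+1] | u <- iota 0 n]; split.
- rewrite -(map_blocks n (m + s) f) /bits; apply: eq_map => i.
  by rewrite /f -divn_eq nth_bits.
- by rewrite size_map size_iota.
- by apply/allP => _ /mapP[u _ ->]; rewrite size_map size_iota.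
rewrite -map_comp -[iota 0 n]val_enum_ord -map_comp; apply: eq_map => u.
transitivity (has (f u) (iota 0 (m + s).+1)); last by symmetry; apply: has_map.
 apply/imsetP/hasP => [[i iS ->] | [x]].
  exists (i %% (m + s).+1); first by rewrite mem_iota ltn_mod.
  by rewrite /= /f /= -divn_eq nth_bits.
rewrite mem_iota /= /f => xB.
rewrite -[_ + x]/(nat_of_ord (vx u (Ordinal xB))) nth_bits => fS.
by exists (vx u (Ordinal xB)); rewrite ?blk_vx.
Qed.

End Encoding.

Theorem theorem9 : poly_reducible min_key min_tss.
Proof.
exists horn_tss, (fun F S => block_set S); split.
(* One input word and 17 empty registers, the last of which receives the output. *)
- apply: (@polytime_den 17 17 horn_tss_prog) wf_horn_tss_prog _ => F _.
  have E := den_horn_tss_prog (size_map _ _) (clauses_wf F); cbv zeta in E.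
  by rewrite -enc_hornE -enc_horn_tss in E.
(* [var_set] and [block_set] exchange feasible solutions of the two problems without increasing the
   size, so the minima agree. *)
- move=> F k; split=> -[[K /= Kf Kk] Kmin]; split.
  + exists (var_set K); first exact: var_set_target.
    by rewrite /= card_var_set.
  + move=> S Sf; apply: leq_trans (card_block_set S).
    by apply: Kmin; apply: block_set_key.
  + exists (block_set K); first exact: block_set_key.
    (* Were [block_set K] smaller than [K], [var_set] would turn it into a target set below the
       minimum. *)
    apply/eqP; rewrite eqn_leq -{1}Kk card_block_set /=.
    rewrite -(card_var_set (block_set K)); apply: Kmin; apply: var_set_target.
    exact: block_set_key.
  + move=> S Sf /=; rewrite -(card_var_set S); apply: Kmin; exact: var_set_target.
- apply: (@polytime_den 9 8 block_set_prog) wf_block_set_prog _ => -[F S] _ /=.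
  have [bss [-> sz allB ->]] := bits_block_set S.
  rewrite enc_hornE; apply: den_block_set_prog => //.
  by rewrite -enc_hornE.
- move=> F S Sf; split; [exact: block_set_key | exact: card_block_set].
Qed.
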